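(* There is an absolute constant $C>0$ such that the following holds. Let $\omega_0$ be initial data on $\mathbb R^2$ with Fourier transform $\hat\omega_0$ for which the norms below are finite, and let $\phi_z(t,z,y)$, $\phi_y(t,z,y)$ be the components of the gradient of the stream function profile, given by $$\phi_z(t,z,y)=\frac{1}{(2\pi)^3}\iint_{\mathbb R^2} e^{i(\xi z+\eta y+\Phi_t(\xi,\eta))}\,\frac{i\xi}{\xi^2+(\eta-t\xi)^2}\,\hat\omega_0(\xi,\eta)\,d\xi\,d\eta,$$ $$\phi_y(t,z,y)=\frac{1}{(2\pi)^3}\iint_{\mathbb R^2} e^{i(\xi z+\eta y+\Phi_t(\xi,\eta))}\,\frac{i\eta}{\xi^2+(\eta-t\xi)^2}\,\hat\omega_0(\xi,\eta)\,d\xi\,d\eta,$$ where $\Phi_t(\xi,\eta)=\frac1\xi\left(\arctan\left(t-\frac{\eta}{\xi}\right)+\arctan\left(\frac{\eta}{\xi}\right)\right)$. Let $\rho=\sqrt{z^2+y^2}$. Then for all $t>0$ and all $(z,y)\in\mathbb R^2\setminus\{0\}$, $$|\phi_z(t,z,y)|\le C\left(\|\langle\xi,\eta\rangle^{5}\hat\omega_0\|_{L^\infty}+\|\langle\xi,\eta\rangle^{6}\nabla_{\xi,\eta}\hat\omega_0\|_{L^\infty}\right)\langle\rho\rangle\,\log(\rho+\rho^{-1}+1)\,\frac{\ln(t+2)}{\langle t\rangle^{3/2}},$$ $$|\phi_y(t,z,y)|\le C\left(\|\langle\xi,\eta\rangle^{5}\hat\omega_0\|_{L^\infty}+\|\langle\xi,\eta\rangle^{6}\nabla_{\xi,\eta}\hat\omega_0\|_{L^\infty}\right)\langle\rho\rangle\,\log(\rho+\rho^{-1}+1)\,\frac{\ln(t+2)}{\langle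 t\rangle}.$$
   Context: Notation: $\langle p\rangle=\sqrt{1+p^2}$ and $\langle\xi,\eta\rangle=\sqrt{1+\xi^2+\eta^2}$. The Fourier transform is $\hat f(\xi,\eta)=\iint_{\mathbb R^2}e^{-i(\xi z+\eta y)}f(z,y)\,dz\,dy$. The $L^\infty$ norms are over $(\xi,\eta)\in\mathbb R^2$. Background: the linearized $\beta$-plane equation near Couette flow (after rescaling) is $\partial_t\omega+y\partial_x\omega-\partial_x\Delta_{x,y}^{-1}\omega=0$ on $\mathbb R^2$ with $\omega(0,\cdot)=\omega_0$. In coordinates $z=x-ty$, the vorticity profile $f(t,z,y)=\omega(t,x,y)$ satisfies $\hat f(t,\xi,\eta)=e^{i\Phi_t(\xi,\eta)}\hat\omega_0(\xi,\eta)$. The function $\phi$ is the profile of the stream function, and $\phi_z,\phi_y$ are its partial derivatives, given by the displayed integrals. *)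

(* Defs.v *)
From HB Require Import structures.
From mathcomp Require Import all_boot all_order all_algebra.
From mathcomp Require Import all_classical all_reals all_analysis.
From mathcomp Require Import complex.

Set Implicit Arguments.
Unset Strict Implicit.
Unset Printing Implicit Defensive.

Import Order.TTheory GRing.Theory Num.Theory.
Import numFieldNormedType.Exports.

Local Open Scope classical_set_scope.
Local Open Scope ring_scope.
Local Open Scope complex_scope.

Section Defs.
Context {R : realType}.
Implicit Types (f g w : R * R -> R[i]) (k x : R * R).

Definition mu2 := (@lebesgue_measure R \x @lebesgue_measure R)%E.

Definition cmod (c : R[i]) : R := Normc.normc c.

Definition expi (a : R) : R[i] := cos a +i* sin a.

Definition cintegrable (D : set (R * R)) f : Prop :=
  mu2.-integrable D (fun x => (complex.Re (f x))%:E) /\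
  mu2.-integrable D (fun x => (complex.Im (f x))%:E).

Definition cintegral f : R[i] :=
  Rintegral mu2 setT (fun x => complex.Re (f x)) +i*
  Rintegral mu2 setT (fun x => complex.Im (f x)).

Definition box (n : nat) : set (R * R) :=
  [set x | `|x.1| <= n%:R /\ `|x.2| <= n%:R].

Definition cmeasurable f : Prop :=
  measurable_fun setT (fun x => complex.Re (f x)) /\
  measurable_fun setT (fun x => complex.Im (f x)).

Definition locally_cintegrable f : Prop := forall n, cintegrable (box n) f.

Definition fourier f k : R[i] :=
  cintegral (fun x => expi (- (k.1 * x.1 + k.2 * x.2)) * f x).

Definition sqnorm2 f : \bar R := (\int[mu2]_x (cmod (f x) ^+ 2)%:E)%E.

(* The Fourier-Plancherel transform on L^2, as the L^2 limit of the Fourier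
   integrals truncated to the squares [-n, n]^2. *)
Definition plancherel_transform w g : Prop :=
  [/\ cmeasurable w, (sqnorm2 w < +oo)%E, cmeasurable g &
      (fun n : nat =>
         sqnorm2 (fun k => fourier (fun x => (\1_(box n) x : R)%:C * w x) k - g k))
        @ \oo --> 0%E].

(* [g] is the Fourier transform of [w]: given by the absolutely convergent
   Fourier integral when [w] is in L^1, and by its L^2 extension when [w] is
   merely in L^2. *)
Definition is_fourier_transform w g : Prop :=
  (cintegrable setT w /\ forall k, g k = fourier w k) \/
  plancherel_transform w g.

(* Weak derivatives are tested against C^1 functions with compact support;
   for locally integrable functions this is the same notion as with smooth
   ones. *)
Definition test_function (psi : R * R -> R) : Prop :=
  [/\ forall k, differentiable psi k,
      forall v : R * R, continuous ('D_v psi) &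
      exists n, forall k, ~ box n k -> psi k = 0].

Definition weak_derivative (v : R * R) g gv : Prop :=
  [/\ locally_cintegrable g, locally_cintegrable gv &
      forall psi, test_function psi ->
        cintegral (fun k => ('D_v psi k)%:C * g k) =
        - cintegral (fun k => (psi k)%:C * gv k)].

Definition is_weak_gradient g g1 g2 : Prop :=
  weak_derivative (1, 0) g g1 /\ weak_derivative (0, 1) g g2.

Definition jap (p : R) : R := Num.sqrt (1 + p ^+ 2).

Definition jap2 k : R := Num.sqrt (1 + k.1 ^+ 2 + k.2 ^+ 2).

Definition Linfty (h : R * R -> R) : \bar R := 'N[mu2]_+oo%E[EFin \o h].

Definition data_norm g g1 g2 : \bar R :=
  (Linfty (fun k => (jap2 k ^+ 5 * cmod (g k))%R) +
   Linfty (fun k => (jap2 k ^+ 6 *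
                     Num.sqrt (cmod (g1 k) ^+ 2 + cmod (g2 k) ^+ 2))%R))%E.

(* Division by [0] only occurs on the null set [k.1 = 0]. *)
Definition phase (t : R) k : R :=
  (k.1)^-1 * (atan (t - k.2 / k.1) + atan (k.2 / k.1)).

Definition phi_z g (t z y : R) : R[i] :=
  (((2 * pi) ^+ 3)^-1)%:C *
  cintegral (fun k =>
    expi (k.1 * z + k.2 * y + phase t k) *
    (0 +i* (k.1 / (k.1 ^+ 2 + (k.2 - t * k.1) ^+ 2))) * g k).

Definition phi_y g (t z y : R) : R[i] :=
  (((2 * pi) ^+ 3)^-1)%:C *
  cintegral (fun k =>
    expi (k.1 * z + k.2 * y + phase t k) *
    (0 +i* (k.2 / (k.1 ^+ 2 + (k.2 - t * k.1) ^+ 2))) * g k).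

End Defs.

(* Main.v *)
Require Import Defs.
From mathcomp Require Import all_boot all_order all_algebra.
From mathcomp Require Import all_classical all_reals all_analysis.
From mathcomp Require Import measurable_realfun ess_sup_inf.
From mathcomp Require Import complex.
From mathcomp Require Import ring lra.
Set Implicit Arguments.
Unset Strict Implicit.
Unset Printing Implicit Defensive.
Import Order.TTheory GRing.Theory Num.Theory.
Import numFieldNormedType.Exports.
Local Open Scope classical_set_scope.
Local Open Scope ring_scope.

(** The phase [total_phase] is the linear function [L = xi z + eta y] plus
    [Phi = A(u) / xi], where [u = eta / xi] is the slope and
    [A(u) = atan (t - u) + atan u]. Everything in the integrals is homogeneous:
    for the radial field [D = xi d_xi + eta d_eta] one has [D L = L],
    [D Phi = - Phi], and [D K = - K] for the kernels [K]. Along rays the phase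
    is thus explicit, [D (L + Phi) = L - Phi], and one integration by parts
    along [D] is all the oscillation that is needed; there is no stationary
    phase.

    Put [r = L / Phi], so that [D r = 2 r], and [q(r) = (1 - r) / (1 + r^2)].
    Split [1 = (1 - r) q(r) + 2 r / (1 + r^2)]. In the first piece the factor
    [1 - r] cancels the zero of the phase derivative: with [theta] the phase,
    [cos theta * K * (1 - r) = - D (sin theta) * K / Phi], and [K / Phi] is
    constant along rays, so that the integration by parts only meets the bounded
    functions [q(r)] and [r q'(r)], the data, and its radial derivative. The
    second piece is not integrated by parts: it is at most
    [2 |L| / |Phi| <= 2 rho |k| / |Phi|]. Both pieces are therefore bounded by
    the integral of [(1 + rho) |K / Phi| <k>^-4] times the norm of the data
    ([oscillatory_integral_le]).

    The data only has a weak gradient, so the integration by parts is the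
    definition of that gradient tested against the field [psi k], where [psi]
    contains a cut-off away from the axis [xi = 0], where the phase is singular,
    and from infinity. As [D] is scale invariant, the cut-offs and their radial
    derivatives are bounded by 1 and disappear by dominated convergence.

    It remains to integrate [|K / Phi|]. Since [sin A <= A] and
    [sin A = t / (sqrt (1 + u^2) sqrt (1 + (t - u)^2))], one gets
    [1 / |Phi| <= |k| M / (t |xi|)] with [M^2 = xi^2 + (eta - t xi)^2]. For the
    kernel [xi / M^2] this leaves [1 / t] times the integral of [<k>^-3 / M],
    which is of size [ln (t + 2) / t]: as a function of [xi], [M] has a single
    minimum, near which [1 / M] is integrated to a logarithm
    ([shear_integral_bound]). The kernel [eta / M^2] is [u] times the previous
    one, and [K / Phi] is then not integrable near [xi = 0]; a tail is split off
    that carries this region ([kernel_y_split]). It is dominated by a Poisson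
    kernel, whose integral in [xi] is [O (1 / t)] without any oscillation. So
    [phi_z] decays like [ln t / t^2] and [phi_y] like [ln t / t]. For [t < 1]
    absolute values suffice. *)

(** * Radial derivatives off the vertical axis *)

Section RadialCalculus.
Context {R : realType}.
Implicit Types (f g d e : R * R -> R) (k v : R * R).

Definition offaxis : set (R * R) := [set k | k.1 != 0].

Lemma open_offaxis : open offaxis.
Proof.
rewrite (_ : offaxis = fst @^-1` (~` [set 0])); last first.
  by apply/seteqP; split=> k /= /eqP.
apply: open_comp; first by move=> k _; exact: cvg_fst.
by apply: closed_openC; exact: closed_eq.
Qed.

(** The function [f] is continuously differentiable off the axis [k.1 = 0] and [d]
    is its derivative along the field [k |-> k]. The partial derivatives are kept
    inside, because test functions need them while the estimates only see [d]. *)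
Definition radial_derivative f d : Prop := exists f1 f2 : R * R -> R,
  forall k, k.1 != 0 ->
    [/\ is_diff k f (fun v => v.1 * f1 k + v.2 * f2 k),
        {for k, continuous f1}, {for k, continuous f2} &
        d k = k.1 * f1 k + k.2 * f2 k].

Lemma radial_derivative_cts f d k : radial_derivative f d -> k.1 != 0 ->
  {for k, continuous f}.
Proof.
move=> [f1 [f2 H]] /H[df _ _ _]; apply: differentiable_continuous.
exact: ex_diff.
Qed.

Lemma eq_radial_derivative f d e : (forall k, k.1 != 0 -> d k = e k) ->
  radial_derivative f d -> radial_derivative f e.
Proof.
move=> de [f1 [f2 H]]; exists f1, f2 => k k0.
by have [? ? ? dE] := H k k0; split => //; rewrite -de.
Qed.

Lemma radial_derivative_cst (c : R) : radial_derivative (fun=> c) (fun=> 0).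
Proof.
exists (fun=> 0), (fun=> 0) => k _; split; try exact: cvg_cst.
  apply: (is_diff_eq (is_diff_cst c k)).
  by apply/funext => v; rewrite !mulr0 addr0.
by rewrite !mulr0 addr0.
Qed.

Lemma is_diff_fst k : is_diff k (fst : R * R -> R) fst.
Proof.
have cf : continuous (fst : R * R -> R) by move=> ?; exact: cvg_fst.
apply: DiffDef; first exact: (@linear_differentiable R _ _ fst).
by rewrite diff_lin.
Qed.

Lemma is_diff_snd k : is_diff k (snd : R * R -> R) snd.
Proof.
have cf : continuous (snd : R * R -> R) by move=> ?; exact: cvg_snd.
apply: DiffDef; first exact: (@linear_differentiable R _ _ snd).
by rewrite diff_lin.
Qed.

Lemma radial_derivative_fst : radial_derivative fst fst.
Proof.
exists (fun=> 1), (fun=> 0) => k _; split; try exact: cvg_cst.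
  by apply: (is_diff_eq (is_diff_fst k)); apply/funext => v; rewrite mulr1 mulr0 addr0.
by rewrite mulr1 mulr0 addr0.
Qed.

Lemma radial_derivative_snd : radial_derivative snd snd.
Proof.
exists (fun=> 0), (fun=> 1) => k _; split; try exact: cvg_cst.
  by apply: (is_diff_eq (is_diff_snd k)); apply/funext => v; rewrite mulr1 mulr0 add0r.
by rewrite mulr1 mulr0 add0r.
Qed.

Lemma radial_derivativeD f g d e : radial_derivative f d ->
  radial_derivative g e ->
  radial_derivative (fun k => f k + g k) (fun k => d k + e k).
Proof.
move=> [f1 [f2 F]] [g1 [g2 G]].
exists (fun k => f1 k + g1 k), (fun k => f2 k + g2 k) => k k0.
have [df cf1 cf2 ->] := F k k0; have [dg cg1 cg2 ->] := G k k0.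
split; [|exact: cvgD|exact: cvgD|by rewrite /=; ring].
by apply: (is_diff_eq (is_diffD df dg)); apply/funext => v /=; rewrite fctE; lra.
Qed.

Lemma radial_derivativeM f g d e : radial_derivative f d ->
  radial_derivative g e ->
  radial_derivative (fun k => f k * g k) (fun k => d k * g k + f k * e k).
Proof.
move=> rf rg; have := rg; have := rf.
move=> [f1 [f2 F]] [g1 [g2 G]].
exists (fun k => f k * g1 k + g k * f1 k), (fun k => f k * g2 k + g k * f2 k).
move=> k k0.
have cf := radial_derivative_cts rf k0; have cg := radial_derivative_cts rg k0.
have [df cf1 cf2 ->] := F k k0; have [dg cg1 cg2 ->] := G k k0.
split; [|by apply: cvgD; exact: cvgM|by apply: cvgD; exact: cvgM|by rewrite /=; ring].
apply: (is_diff_eq (is_diffM df dg)); apply/funext => v.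
transitivity (f k * (v.1 * g1 k + v.2 * g2 k) +
              g k * (v.1 * f1 k + v.2 * f2 k)) => //.
by case: v => a b /=; ring.
Qed.

(** Chain rule. For a homogeneous function of degree 0, such as the slope, the
    factor [d] vanishes, and the derivative of the outer function is irrelevant. *)
Lemma radial_derivative_comp (h h' : R -> R) f d :
  radial_derivative f d ->
  (forall k, k.1 != 0 -> is_derive (f k) 1 h (h' (f k))) ->
  (forall k, k.1 != 0 -> {for f k, continuous h'}) ->
  radial_derivative (fun k => h (f k)) (fun k => h' (f k) * d k).
Proof.
move=> rf hd hc; have := rf => -[f1 [f2 F]].
exists (fun k => h' (f k) * f1 k), (fun k => h' (f k) * f2 k) => k k0.
have cf := radial_derivative_cts rf k0.
have ch : {for k, continuous (h' \o f)}.
  by apply: continuous_comp => //; exact: hc.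
have [df cf1 cf2 ->] := F k k0.
split; [|exact: cvgM|exact: cvgM|by rewrite /=; ring].
have [/derivable1_diffP dh h'E] := hd k k0.
have dhE : is_diff (f k) h (fun x : R => x * h' (f k)).
  apply: DiffDef => //; apply/funext => x.
  rewrite -[in LHS](mulr1 x) -[in LHS]/(x *: 1) linearZ /=.
  by rewrite -deriveE // h'E.
apply: (is_diff_eq (is_diff_comp df dhE)).
by apply/funext => v /=; lra.
Qed.

Lemma radial_derivativeN f d : radial_derivative f d ->
  radial_derivative (fun k => - f k) (fun k => - d k).
Proof.
move=> rf; have := radial_derivativeM (radial_derivative_cst (-1)) rf.
move=> [f1 [f2 F]]; exists f1, f2 => k /F[fE c1 c2 dE]; split => //.
  suff -> : (fun k0 => - f k0) = (fun k0 => -1 * f k0) by [].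
  by apply/funext => k0; rewrite mulN1r.
by rewrite -dE; ring.
Qed.

Lemma radial_derivativeV f d : radial_derivative f d ->
  (forall k, k.1 != 0 -> f k != 0) ->
  radial_derivative (fun k => (f k)^-1) (fun k => - (f k) ^- 2 * d k).
Proof.
move=> rf f0.
apply: (@radial_derivative_comp GRing.inv (fun x => - x ^- 2)) => //.
- move=> k k0; apply: is_derive_eq; first exact: (is_deriveV (f0 k k0)).
  by rewrite /GRing.scale /= mulr1.
- move=> k k0; apply: cvgN; apply: cvgV; first by rewrite expf_neq0 ?f0.
  exact: exprn_continuous.
Qed.

End RadialCalculus.

(** * Radial fields as test functions *)

Section TestFields.
Context {R : realType}.
Implicit Types (f g d e : R * R -> R) (k v : R * R).

(** Needed on the axis, where the cut-off makes a field vanish identically nearby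
    although its formula is singular. *)
Lemma is_diff_near0 f k : (\forall x \near k, f x = 0) ->
  is_diff k f (fun=> 0).
Proof.
move=> f0.
have c0 : continuous (0 : R * R -> R) by exact: cst_continuous.
have fE : f \o shift k = cst (f k) + \0 +o_ (0 : R * R) id.
  apply/eqaddoP => _/posnumP[eps].
  have fk0 : f k = 0 by exact: nbhs_singleton f0.
  have f0' : \forall x \near (0 : R * R), f (x + k) = 0.
    by rewrite (near_shift k 0); apply: filterS f0 => x fx /=; rewrite sub0r subrK.
  near=> x; rewrite /= !fctE fk0 (_ : f (x + k) = 0); last by near: x.
  by rewrite addr0 subr0 normr0 mulr_ge0.
have dE : 'd f k = 0 :> (R * R -> R) by exact/diff_unique.
by apply: DiffDef => //; apply/diff_locallyP; rewrite dE.
Unshelve. all: by end_near. Qed.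

(** A function that is regular off the axis and vanishes near it is regular
    everywhere, so that multiplying by a cut-off suffices to obtain test functions. *)
Lemma radial_derivative_test f d eps n : radial_derivative f d -> 0 < eps ->
  (forall k, `|k.1| < eps -> f k = 0) -> (forall k, ~ box n k -> f k = 0) ->
  test_function f.
Proof.
move=> [f1 [f2 F]] eps0 f0 fn.
have near0 k : k.1 = 0 -> \forall x \near k, f x = 0.
  move=> k0.
  have : \forall x \near k, `|x.1| < eps.
    have /cvgrPdist_lt/(_ _ eps0) : fst x @[x --> k] --> k.1 by exact: cvg_fst.
    by rewrite k0; apply: filterS => x; rewrite sub0r normrN.
  by apply: filterS => x; exact: f0.
have dE v k : 'D_v f k = if k.1 == 0 then 0 else v.1 * f1 k + v.2 * f2 k.
  case: ifPn => [/eqP k0|k0].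
    have df := is_diff_near0 (near0 _ k0).
    by rewrite deriveE ?diff_val //; exact: ex_diff.
  have [df _ _ _] := F k k0.
  by rewrite deriveE ?diff_val //; exact: ex_diff.
split; last by exists n.
- move=> k; have [k0|k0] := eqVneq k.1 0.
    by have [] := is_diff_near0 (near0 _ k0).
  by have [[]] := F k k0.
- move=> v k; have [k0|k0] := eqVneq k.1 0.
    have : \forall x \near k, 'D_v f x = 'D_v f k.
      have /near_join := near0 _ k0; apply: filterS => x fx.
      have df := is_diff_near0 fx.
      rewrite [RHS]dE k0 eqxx.
      by rewrite deriveE ?diff_val //; exact: ex_diff.
    exact: cvg_near_cst.
  have [df c1 c2 _] := F k k0.
  have : (v.1 * f1 x + v.2 * f2 x) @[x --> k] --> 'D_v f k.
    rewrite dE (negbTE k0).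
    by apply: cvgD; apply: cvgM => //; exact: cvg_cst.
  apply: cvg_trans; apply: near_eq_cvg.
  have : nbhs k (offaxis : set (R * R)) by apply: open_nbhs_nbhs; split => //; exact: open_offaxis.
  by apply: filterS => x x0; rewrite dE (negbTE x0).
Qed.

(** In the plane, [div (f k) = D f + 2 f]: the field [k] itself has divergence 2. *)
Lemma radial_divergence f d k : radial_derivative f d -> k.1 != 0 ->
  'D_(1, 0) (fun k => f k * k.1) k + 'D_(0, 1) (fun k => f k * k.2) k =
  d k + 2 * f k.
Proof.
move=> [f1 [f2 F]] k0; have [df _ _ ->] := F k k0.
have df1 := is_diffM df (is_diff_fst k); have df2 := is_diffM df (is_diff_snd k).
rewrite !deriveE; try exact: ex_diff.
have -> : 'd (fun k => f k * k.1) k (1, 0) = f k * 1 + k.1 * (1 * f1 k + 0 * f2 k).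
  by rewrite (@diff_val _ _ _ _ _ _ _ df1).
have -> : 'd (fun k => f k * k.2) k (0, 1) = f k * 1 + k.2 * (0 * f1 k + 1 * f2 k).
  by rewrite (@diff_val _ _ _ _ _ _ _ df2).
ring.
Qed.
End TestFields.

(** * The arctangent sum and a smooth ramp *)

Section Phase.
Context {R : realType}.

Lemma sin_le_id (x : R) : 0 <= x -> sin x <= x.
Proof.
move=> x0; have [|c _] := @MVT_segment R sin cos 0 x x0.
  by apply: continuous_subspaceT => c; exact: continuous_sin.
rewrite sin0 !subr0 => ->.
by rewrite ler_piMl // cos_le1.
Qed.

Lemma sin_atan (x : R) : sin (atan x) = x / Num.sqrt (1 + x ^+ 2).
Proof.
rewrite -cos_atan -{2}(atanK x) /tan mulfVK // gt_eqF // cos_gt0_pihalf //.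
by rewrite atan_gtNpi2 atan_ltpi2.
Qed.

(** The right-hand side is nonnegative and its sine is exactly the left-hand side. *)
Lemma atan_sum_ge (t u : R) : 0 < t ->
  t / (Num.sqrt (1 + u ^+ 2) * Num.sqrt (1 + (t - u) ^+ 2)) <=
  atan (t - u) + atan u.
Proof.
move=> t0; have -> : t / (Num.sqrt (1 + u ^+ 2) * Num.sqrt (1 + (t - u) ^+ 2)) =
  sin (atan (t - u) + atan u).
  rewrite sinD !sin_atan !cos_atan invfM; ring.
apply: sin_le_id; rewrite -lerBlDr sub0r -atanN; apply: le_atan; lra.
Qed.

(** The square of the positive part: the simplest ramp that is continuously
    differentiable, which is all that test functions require. *)
Definition ramp2 (x : R) : R := Num.max 0 x ^+ 2.

Lemma is_derive_ramp2 (x : R) : is_derive x 1 ramp2 (2 * Num.max 0 x).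
Proof.
have [x0|x0|->] := ltgtP x 0.
- rewrite mulr0; apply: (near_eq_is_derive (f := cst 0));
  near=> y; rewrite /ramp2.
  have y0 : y < 0 by near: y; exact: lt_nbhsl.
  by rewrite (max_idPl (ltW y0)) expr0n.
- have dX : is_derive x (1 : R) ((id : R -> R) ^+ 2) (2 * x).
    apply: (is_derive_eq (is_deriveX _ _)).
    by rewrite /GRing.scale /=; ring.
  apply: (near_eq_is_derive _ dX).
  near=> y; rewrite /ramp2 fctE.
  have y0 : 0 < y by near: y; exact: lt_nbhsr.
  by rewrite (max_idPr (ltW y0)).
(* at the corner the difference quotient is at most [|h|] *)
- rewrite mulr0.
  have cn : (fun h : R => `|h|) @ 0^' --> (0 : R).
    apply: cvg_within_filter.
    by have := @norm_continuous _ R 0; rewrite /continuous_at normr0.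
  have cv : (fun h : R => h^-1 *: ((ramp2 \o shift 0) (h *: 1) - ramp2 0)) @ 0^' --> (0 : R).
    apply: (@squeeze_cvgr _ _ _ _ (fun h => - `|h|) (fun h => `|h|)).
    + near=> h.
      have h0 : h != 0 by near: h; exact: nbhs_dnbhs_neq.
      rewrite -ler_norml /ramp2 /= addr0 maxxx expr0n subr0 /GRing.scale /= mulr1.
      have [hn|hp] := leP h 0.
        by rewrite expr0n mulr0 normr0.
      by rewrite expr2 mulKf.
    + by have := cvgN cn; rewrite oppr0 => cnN; exact: cnN.
    + exact: cn.
  apply: DeriveDef; first by apply: cvgP; exact: cv.
  exact: (cvg_lim _ cv).
Unshelve. all: by end_near. Qed.

Lemma continuous_ramp2' : continuous (fun x : R => 2 * Num.max 0 x).
Proof.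
move=> x; apply: cvgM; first exact: cvg_cst.
by apply: continuous_max; [exact: cvg_cst|exact: cvg_id].
Qed.
End Phase.

(** * Integrals over the line by bounded antiderivatives *)

Section LineIntegrals.
Context {R : realType}.
Local Notation mu := (@lebesgue_measure R).

Lemma integral_segment_le (f F : R -> R) (a b C : R) : a < b ->
  (forall x, a <= x <= b -> is_derive x 1 F (f x)) ->
  (forall x, a <= x <= b -> {for x, continuous f}) ->
  (forall x, a <= x <= b -> `|F x| <= C) ->
  (\int[mu]_(x in `[a, b]) (f x)%:E <= (2 * C)%:E)%E.
Proof.
move=> ab dF cf FC.
have dF' x : a <= x <= b -> differentiable F x.
  by move=> /dF[/derivable1_diffP].
have cF x : a <= x <= b -> {for x, continuous F}.
  by move=> /dF' /differentiable_continuous.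
rewrite (@continuous_FTC2 _ f F) //.
- rewrite -EFinB lee_fin (le_trans (ler_norm _)) // (le_trans (ler_normB _ _)) //.
  have := FC a; have := FC b; rewrite !lexx (ltW ab) => /(_ isT) ? /(_ isT) ?; lra.
- apply: continuous_in_subspaceT => x; rewrite inE /= in_itv /=; exact: cf.
- split.
  + move=> x; rewrite in_itv /= => /andP[ax xb].
    by apply/derivable1_diffP/dF'; rewrite !ltW.
  + by apply: cvg_at_right_filter; apply: cF; rewrite lexx ltW.
  + by apply: cvg_at_left_filter; apply: cF; rewrite lexx ltW.
- move=> x; rewrite in_itv /= => /andP[ax xb].
  by rewrite derive1E; have [|_ ->] := dF x; rewrite ?ltW.
Qed.

(** Exhaust the complement of [p] by the sets of points at distance between
    [1 / (n + 1)] and [n + 2] from [p]; each consists of two segments, on which the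
    fundamental theorem of calculus gives at most [2 C]. *)
Lemma integral_antiderivative_le (f F : R -> R) (p C : R) :
  measurable_fun setT f -> (forall x, 0 <= f x) ->
  (forall x, x != p -> is_derive x 1 F (f x)) ->
  (forall x, x != p -> {for x, continuous f}) ->
  (forall x, x != p -> `|F x| <= C) ->
  (\int[mu]_x (f x)%:E <= (4 * C)%:E)%E.
Proof.
move=> mf f0 dF cf FC.
pose A (n : nat) : set R :=
  `[p - n.+2%:R, p - n.+1%:R^-1] `|` `[p + n.+1%:R^-1, p + n.+2%:R].
have AE n x : A n x <-> n.+1%:R^-1 <= `|x - p| <= n.+2%:R.
  have n0 : (0 : R) < n.+1%:R^-1 by rewrite invr_gt0.
  rewrite /A /= !in_itv /=; set q := _^-1 in n0 *; set Q := n.+2%:R; split => [[]/andP[h1 h2]|].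
  - rewrite ltr0_norm; last lra; apply/andP; split; lra.
  - rewrite gtr0_norm; last lra; apply/andP; split; lra.
  - have [h|h] := leP 0 (x - p); rewrite ?(ger0_norm h) ?(ltr0_norm h) => /andP[h1 h2]; [right|left]; apply/andP; split; lra.
have mA n : measurable (A n) by apply: measurableU.
have inv1 n : (n.+1%:R : R)^-1 <= 1 by rewrite invf_le1 ?ler1n.
have n2 n : (1 : R) < n.+2%:R by rewrite ltr1n.
have intA n : (\int[mu]_(x in A n) (f x)%:E <= (4 * C)%:E)%E.
  have n0 : (0 : R) < n.+1%:R^-1 by rewrite invr_gt0.
  rewrite /A; set q := _^-1 in n0 *; set Q := n.+2%:R.
  have h1 : q <= 1 := inv1 n; have h2 : 1 < Q := n2 n.
  rewrite ge0_integral_setU //=; first last.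
  - apply/disj_setPS => x [/=]; rewrite !in_itv /= => /andP[_ h3] /andP[h4 _].
    by suff : False by []; lra.
  - by move=> x _; rewrite lee_fin.
  - by apply/measurable_EFinP; exact: measurable_funTS.
  have -> : 4 * C = 2 * C + 2 * C by ring.
  rewrite EFinD; apply: leeD; apply: (@integral_segment_le _ F) => //; try lra;
    move=> x /andP[xa xb]; [apply: dF|apply: cf|apply: FC|apply: dF|apply: cf|apply: FC];
    apply/eqP => xp; lra.
have -> : (\int[mu]_x (f x)%:E = \int[mu]_(x in \bigcup_n A n) (f x)%:E)%E.
  rewrite -(@integral_setD1 _ _ p); first last.
  - by apply/measurable_EFinP; exact: measurable_funTS.
  - exact: measurableD.
  congr (integral mu _ _); apply/seteqP; split => [x [_ /= /eqP xp]|x [n _ /AE/andP[h _]]].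
    have xp0 : 0 < `|x - p| by rewrite normr_gt0 subr_eq0.
    (* archimedean bounds of the distance and of its inverse *)
    pose m := maxn (Num.bound `|x - p|) (Num.bound `|x - p|^-1).
    exists m => //; apply/AE; apply/andP; split.
      rewrite -[leRHS]invrK lef_pV2 ?posrE ?invr_gt0 //.
      apply: (le_trans (ltW (archi_boundP _))); first by rewrite invr_ge0.
      by rewrite ler_nat; apply: leqW; exact: leq_maxr.
    apply: (le_trans (ltW (archi_boundP _))) => //.
    by rewrite ler_nat; do 2 apply: leqW; exact: leq_maxl.
  split => //= xp; move: h; rewrite xp subrr normr0.
  by rewrite leNgt invr_gt0 ltr0Sn.
have cvA : (\int[mu]_(x in A n) (f x)%:E @[n --> \oo] -->
    \int[mu]_(x in \bigcup_n A n) (f x)%:E)%E.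
  apply: ge0_nondecreasing_set_cvg_integral => //.
  - move=> m n mn; apply/subsetPset => x /AE/andP[h1 h2]; apply/AE/andP; split.
      by rewrite (le_trans _ h1) // lef_pV2 ?posrE // ler_nat ltnS.
    by rewrite (le_trans h2) // ler_nat ltnS ltnS.
  - by move=> n; apply/measurable_EFinP; exact: measurable_funTS.
  - by move=> n x _; rewrite lee_fin.
rewrite -(cvg_lim _ cvA) //; apply: lime_le; last exact: nearW.
exact: cvgP cvA.
Qed.
(** A single point is measurable, and so is a function that is continuous on the
    complement of one. *)
Lemma continuous_off_measurable (f : R -> R) (p : R) :
  (forall x, x != p -> {for x, continuous f}) -> measurable_fun setT f.
Proof.
move=> cf; rewrite -(setvU [set p]).
have o : open (~` [set p] : set R) by apply: closed_openC; exact: closed_eq.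
apply/measurable_funU => //; first exact: open_measurable.
split; last exact: measurable_fun_set1.
by apply: open_continuous_measurable_fun => // x; rewrite inE => /eqP; exact: cf.
Qed.

(** Symmetric profiles have the odd antiderivative given by [G (x - p)] to the right
    of [p] and [- G (p - x)] to the left. No continuity at [p] is asked, which
    admits the integrable singularity of [integral_rsqrt_le]. *)
Lemma integral_even_le (g G : R -> R) (p C : R) :
  (forall r : R, 0 <= r -> 0 <= g r) ->
  (forall r : R, 0 < r -> is_derive r 1 G (g r)) ->
  (forall r : R, 0 < r -> {for r, continuous g}) ->
  (forall r : R, 0 < r -> `|G r| <= C) ->
  measurable_fun setT (fun x : R => g `|x - p|) /\
  (\int[mu]_x (g `|x - p|)%:E <= (4 * C)%:E)%E.
Proof.
move=> g0 dG cg GC.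
have cf x : x != p -> {for x, continuous (fun x => g `|x - p|)}.
  move=> xp; have xp0 : 0 < `|x - p| by rewrite normr_gt0 subr_eq0.
  apply: (@continuous_comp _ _ _ (fun x => `|x - p|) g); last exact: cg.
  apply: (@continuous_comp _ _ _ (fun x => x - p) Num.norm).
    by apply: cvgB; [exact: cvg_id|exact: cvg_cst].
  exact: norm_continuous.
have mf := continuous_off_measurable cf; split => //.
pose F x := if p < x then G (x - p) else - G (p - x).
apply: (@integral_antiderivative_le _ F p) => //; first by move=> x; exact: g0.
- move=> x; rewrite neq_lt => /orP[xp|xp].
    have d1 : is_derive x (1 : R) (fun y => p - y) (-1).
      by apply: (is_derive_eq (is_deriveB (is_derive_cst p x 1) (is_derive_id x 1))); rewrite sub0r.
    have d2 : is_derive (p - x) 1 G (g (p - x)) by apply: dG; rewrite subr_gt0.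
    have h : is_derive x 1 (fun y => - G (p - y)) (g `|x - p|).
      rewrite ltr0_norm ?subr_lt0 // opprB.
      have -> : g (p - x) = - (g (p - x) * -1) by ring.
      exact: is_deriveN (@is_derive1_comp _ G (fun y => p - y) x _ _ d2 d1).
    apply: (near_eq_is_derive _ h); near=> y.
    have yp : y < p by near: y; exact: lt_nbhsl.
    by rewrite /F ltNge (ltW yp).
  have d1 : is_derive x (1 : R) (fun y => y - p) 1.
    by apply: (is_derive_eq (is_deriveB (is_derive_id x 1) (is_derive_cst p x 1))); rewrite subr0.
  have d2 : is_derive (x - p) 1 G (g (x - p)) by apply: dG; rewrite subr_gt0.
  have h : is_derive x 1 (fun y => G (y - p)) (g `|x - p|).
    rewrite gtr0_norm ?subr_gt0 // -[g _]mulr1.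
    exact: (@is_derive1_comp _ G (fun y => y - p) x _ _ d2 d1).
  apply: (near_eq_is_derive _ h); near=> y.
  have yp : p < y by near: y; exact: lt_nbhsr.
  by rewrite /F yp.
- move=> x; rewrite /F neq_lt => /orP[xp|xp].
    by rewrite ltNge (ltW xp) normrN; apply: GC; rewrite subr_gt0.
  by rewrite xp; apply: GC; rewrite subr_gt0.
Unshelve. all: by end_near. Qed.
End LineIntegrals.

Section ExplicitLineIntegrals.
Context {R : realType}.
Local Notation mu := (@lebesgue_measure R).

Lemma norm_atan_le2 (x : R) : `|atan x| <= 2.
Proof.
have h1 := atan_gtNpi2 x; have h2 := atan_ltpi2 x; have h3 := @pihalf_lt2 R.
by rewrite ler_norml; apply/andP; split; lra.
Qed.

Lemma integral_cauchy_le (p : R) :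
  measurable_fun setT (fun x : R => (1 + `|x - p| ^+ 2)^-1) /\
  (\int[mu]_x ((1 + `|x - p| ^+ 2)^-1)%:E <= 8%:E)%E.
Proof.
have -> : 8%:E = (4 * 2)%:E :> \bar R by congr EFin; ring.
apply: (@integral_even_le _ (fun r => (1 + r ^+ 2)^-1) atan).
- by move=> r _; rewrite invr_ge0 addr_ge0 // sqr_ge0.
- move=> r _; apply: cvgV; first by rewrite gt_eqF // ltr_pwDl // sqr_ge0.
  by apply: cvgD; [exact: cvg_cst|exact: exprn_continuous].
- by move=> r _; exact: norm_atan_le2.
Qed.

Lemma integral_rsqrt_le :
  measurable_fun setT (fun x : R => (Num.sqrt `|x| * (1 + `|x|))^-1) /\
  (\int[mu]_x ((Num.sqrt `|x| * (1 + `|x|))^-1)%:E <= 16%:E)%E.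
Proof.
have e (x : R) : `|x| = `|x - 0| by rewrite subr0.
under eq_fun do rewrite e; under eq_integral do rewrite e.
have -> : 16%:E = (4 * 4)%:E :> \bar R by congr EFin; ring.
apply: (@integral_even_le _ (fun r => (Num.sqrt r * (1 + r))^-1)
  (fun r => 2 * atan (Num.sqrt r))).
- by move=> r r0; rewrite invr_ge0 mulr_ge0 ?sqrtr_ge0 ?addr_ge0.
- move=> r r0.
  have sr0 : 0 < Num.sqrt r by rewrite sqrtr_gt0.
  have d1 := is_derive1_sqrt r0.
  have d2 := is_derive1_atan (Num.sqrt r).
  have d3 := is_deriveZ 2 (@is_derive1_comp _ atan Num.sqrt r _ _ d2 d1).
  apply: (is_derive_eq d3).
  rewrite /GRing.scale /= sqr_sqrtr ?ltW //; field.
  by apply/andP; split; apply: lt0r_neq0 => //; lra.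
- move=> r r0; apply: cvgV.
    by rewrite gt_eqF // mulr_gt0 ?sqrtr_gt0 // addr_gt0.
  apply: cvgM; first exact: sqrt_continuous.
  by apply: cvgD; [exact: cvg_cst|exact: cvg_id].
- by move=> r _; rewrite normrM ger0_norm //; have := norm_atan_le2 (Num.sqrt r); lra.
Qed.

(** By partial fractions [1 / ((s + a) (s + a + 1))] has the antiderivative
    [ln (s + a) - ln (s + a + 1)]; it agrees with [1 / (s + a)] near [s = 0] but is
    integrable at infinity. *)
Lemma integral_log_kernel_le (a p : R) : 0 < a ->
  measurable_fun setT (fun x : R => ((`|x - p| + a) * (`|x - p| + a + 1))^-1) /\
  (\int[mu]_x (((`|x - p| + a) * (`|x - p| + a + 1))^-1)%:E <=
    (4 * ln (1 + a^-1))%:E)%E.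
Proof.
move=> a0.
apply: (@integral_even_le _ (fun r => ((r + a) * (r + a + 1))^-1)
  (fun r => ln (r + a) - ln (r + a + 1))).
- by move=> r r0; rewrite invr_ge0 mulr_ge0 ?addr_ge0 // ltW.
- move=> r r0.
  have ra : 0 < r + a by rewrite addr_gt0.
  have ra1 : 0 < r + a + 1 by rewrite addr_gt0.
  have e1 c : is_derive r (1 : R) (fun y => y + c) 1.
    by apply: (is_derive_eq (is_deriveD (is_derive_id r 1) (is_derive_cst c r 1))); rewrite addr0.
  have d1 := @is_derive1_comp _ (@ln R) (fun y => y + a) r _ _ (is_derive1_ln ra) (e1 a).
  have d2 : is_derive r (1 : R) (fun y => ln (y + a + 1)) ((r + a + 1)^-1 * 1).
    have e2 : is_derive r (1 : R) (fun y => y + a + 1) 1.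
      by under eq_fun do rewrite -addrA; exact: e1.
    exact: (@is_derive1_comp _ (@ln R) (fun y => y + a + 1) r _ _ (is_derive1_ln ra1) e2).
  apply: (is_derive_eq (is_deriveB d1 d2)); field.
  by rewrite gt_eqF //= gt_eqF.
- move=> r r0; apply: cvgV.
    by rewrite gt_eqF // mulr_gt0 // ?addr_gt0.
  have c1 : (fun y : R => y + a) @ r --> r + a by apply: cvgD; [exact: cvg_id|exact: cvg_cst].
  by apply: cvgM => //; apply: cvgD => //; exact: cvg_cst.
- move=> r r0.
  have ra : 0 < r + a by rewrite addr_gt0.
  have ra1 : 0 < r + a + 1 by rewrite addr_gt0.
  rewrite ler0_norm; last by rewrite subr_le0 ler_ln ?posrE //; lra.
  rewrite opprB -ln_div ?posrE // ler_ln ?posrE ?divr_gt0 //; last first.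
    by rewrite addr_gt0 // invr_gt0.
  by rewrite mulrDl divff ?gt_eqF // lerD2l mul1r lef_pV2 ?posrE //; lra.
Qed.

Lemma integral_poisson_kernel_le (b t : R) : 0 < b -> 0 < t ->
  measurable_fun setT (fun x : R => b / (b ^+ 2 + t ^+ 2 * x ^+ 2)) /\
  (\int[mu]_x (b / (b ^+ 2 + t ^+ 2 * x ^+ 2))%:E <= (8 / t)%:E)%E.
Proof.
have e (x : R) : x ^+ 2 = `|x - 0| ^+ 2 by rewrite subr0 (real_normK (num_real x)).
under eq_fun => x do rewrite (e x); under eq_integral => x _ do rewrite (e x).
move=> b0 t0.
have den r : 0 < b ^+ 2 + t ^+ 2 * r ^+ 2.
  by rewrite ltr_pwDl ?exprn_gt0 // mulr_ge0 // sqr_ge0.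
have -> : (8 / t)%:E = (4 * (2 / t))%:E :> \bar R by congr EFin; field; rewrite gt_eqF.
apply: (@integral_even_le _ (fun r => b / (b ^+ 2 + t ^+ 2 * r ^+ 2))
  (fun r => t^-1 * atan (t / b * r))).
- by move=> r _; rewrite divr_ge0 // ltW.
- move=> r _.
  have e1 : is_derive r (1 : R) (fun y => t / b * y) (t / b).
    by apply: (is_derive_eq (is_deriveZ (t / b) (is_derive_id r 1))); rewrite /GRing.scale /= mulr1.
  have d3 := is_deriveZ t^-1 (@is_derive1_comp _ atan (fun y => t / b * y) r _ _ (is_derive1_atan _) e1).
  apply: (is_derive_eq d3); rewrite /GRing.scale /=; field.
  rewrite ?gt_eqF //=; have := den r; rewrite !expr2; nra.
- move=> r _; apply: cvgM; first exact: cvg_cst.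
  apply: cvgV; first by rewrite gt_eqF.
  apply: cvgD; first exact: cvg_cst.
  by apply: cvgM; [exact: cvg_cst|exact: exprn_continuous].
- move=> r _; rewrite normrM gtr0_norm ?invr_gt0 // mulrC ler_pM2r ?invr_gt0 //.
  exact: norm_atan_le2.
Qed.
End ExplicitLineIntegrals.

(** * Bounds on integrals of nonnegative functions *)

Section BoundedIntegral.
Context {d : measure_display} {T : measurableType d} {R : realType}.
Variable m : {measure set T -> \bar R}.
Implicit Types (f g : T -> R) (b c : R).

Definition integral_bound f c : Prop :=
  [/\ measurable_fun setT f, forall x, 0 <= f x &
      (\int[m]_x (f x)%:E <= c%:E)%E].

Lemma integral_boundD f g b c : integral_bound f b -> integral_bound g c ->
  integral_bound (fun x => f x + g x) (b + c).
Proof.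
move=> [mf f0 fb] [mg g0 gc]; split.
- exact: measurable_funD.
- by move=> x; rewrite addr_ge0.
- under eq_integral do rewrite EFinD.
  rewrite ge0_integralD //; [by rewrite EFinD leeD| | | |].
  + by move=> x _; rewrite lee_fin.
  + exact/measurable_EFinP.
  + by move=> x _; rewrite lee_fin.
  + exact/measurable_EFinP.
Qed.

Lemma integral_boundZ f b c : 0 <= c -> integral_bound f b ->
  integral_bound (fun x => c * f x) (c * b).
Proof.
move=> c0 [mf f0 fb]; split.
- by apply: measurable_funM => //; exact: measurable_cst.
- by move=> x; rewrite mulr_ge0.
- under eq_integral do rewrite EFinM.
  rewrite ge0_integralZl //; first by rewrite EFinM lee_wpmul2l ?lee_fin.
  + exact/measurable_EFinP.
  + by move=> x _; rewrite lee_fin.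
Qed.

Lemma integral_bound_le f g c : measurable_fun setT f -> (forall x, 0 <= f x) ->
  {ae m, forall x, f x <= g x} -> integral_bound g c -> integral_bound f c.
Proof.
move=> mf f0 fg [mg g0 gc]; split => //; apply: le_trans gc.
apply: ae_ge0_le_integral => //.
- by move=> x _; rewrite lee_fin.
- exact/measurable_EFinP.
- by move=> x _; rewrite lee_fin.
- exact/measurable_EFinP.
- by apply: filterS fg => x fg _; rewrite lee_fin.
Qed.

Lemma integral_bound_weaken f b c : b <= c -> integral_bound f b ->
  integral_bound f c.
Proof. by move=> bc [mf f0 fb]; split => //; apply: le_trans fb _; rewrite lee_fin. Qed.

End BoundedIntegral.

Section Tonelli.
Context {R : realType}.
Local Notation mu := (@lebesgue_measure R).

Lemma measurable_inv : measurable_fun setT (GRing.inv : R -> R).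
Proof.
by apply: (@continuous_off_measurable _ _ 0) => x x0; exact: inv_continuous.
Qed.

(** The exceptional line [y = 0] is where the inner integrals below diverge. *)
Lemma tonelli_bound (f : R * R -> R) (h : R -> R) (c : R) :
  measurable_fun setT f -> (forall k, 0 <= f k) ->
  (forall y, y != 0 -> integral_bound mu (fun x => f (x, y)) (h y)) ->
  integral_bound mu h c -> integral_bound mu2 f c.
Proof.
move=> mf f0 fh [mh h0 hc]; split => //; apply: le_trans hc.
rewrite (@fubini_tonelli2 _ _ _ _ _ mu mu (EFin \o f)) //=; first last.
- exact/measurable_EFinP.
apply: ae_ge0_le_integral => //.
- by move=> y _; apply: integral_ge0 => x _; rewrite /= lee_fin.
- apply: measurable_fun_fubini_tonelli_G => //=.
  + exact/measurable_EFinP.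
- by move=> x _; rewrite lee_fin.
- exact/measurable_EFinP.
- exists [set 0]; split => //; first exact: lebesgue_measure_set1.
  move=> y /= h1; apply: contrapT => /eqP y0; apply: h1 => _.
  by have [_ _] := fh _ y0.
Qed.

End Tonelli.

(** * Weighted integrals over the plane *)

Ltac measurability :=
  repeat first [ assumption | exact: measurable_cst | exact: measurable_fst
    | exact: measurable_snd | exact: measurable_id
    | apply: measurable_funM | apply: measurable_funD | apply: measurable_funN
    | apply: measurable_funX
    | apply: (measurableT_comp measurable_inv)
    | apply: (measurableT_comp (continuous_measurable_fun (@sqrt_continuous _)))
    | apply: (measurableT_comp (@normr_measurable _ setT))
    | apply: (measurableT_comp (continuous_measurable_fun (@continuous_cos _)))
    | apply: (measurableT_comp (continuous_measurable_fun (@continuous_sin _)))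
    | apply: (measurableT_comp (continuous_measurable_fun (@continuous_atan _)))
    | apply: measurable_maxr ].

Section PlaneWeights.
Context {R : realType}.
Local Notation mu := (@lebesgue_measure R).

(** An integrable weight that dominates the singularity [1 / |k|] of the kernels
    once tensorized, since [sqrt (|x| |y|) <= |(x, y)|]. *)
Definition rsqrt_weight (x : R) : R := (Num.sqrt `|x| * (1 + `|x|))^-1.

Lemma rsqrt_weight_bound : integral_bound mu rsqrt_weight 16.
Proof.
have [mf fc] := @integral_rsqrt_le R; split => // x.
by rewrite invr_ge0 mulr_ge0 ?sqrtr_ge0 ?addr_ge0.
Qed.

Lemma rsqrt_weight2_bound :
  integral_bound mu2 (fun k : R * R => rsqrt_weight k.1 * rsqrt_weight k.2) 256.
Proof.
have [mw w0 _] := rsqrt_weight_bound.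
apply: (@tonelli_bound _ _ (fun y => 16 * rsqrt_weight y)).
- apply: measurable_funM.
  + by apply: (measurableT_comp mw); exact: measurable_fst.
  + by apply: (measurableT_comp mw); exact: measurable_snd.
- by move=> k; rewrite mulr_ge0.
- move=> y _ /=; rewrite mulrC; under eq_fun do rewrite mulrC.
  by apply: integral_boundZ => //; exact: rsqrt_weight_bound.
- have -> : 256 = 16 * 16 :> R by ring.
  by apply: integral_boundZ => //; exact: rsqrt_weight_bound.
Qed.

(** The modulus of the frequency [(xi, eta - t xi)] transported by the shear. *)
Definition shear_norm (t : R) (k : R * R) : R :=
  Num.sqrt (k.1 ^+ 2 + (k.2 - t * k.1) ^+ 2).

(** Only a positive lower bound matters: it lets constants be absorbed in the
    logarithm. *)
Lemma ln_ge_half (t : R) : 0 <= t -> 2^-1 <= ln (t + 2).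
Proof.
move=> t0; have h : ln (2^-1 : R) <= - 2^-1.
  have e : 1 + - 2^-1 = 2^-1 :> R by field.
  by have := @le_ln1Dx R (- 2^-1); rewrite e; apply; lra.
rewrite lnV ?posrE // lerN2 in h.
by rewrite (le_trans h) // ler_ln ?posrE //; lra.
Qed.

(** The length scale [b / (1 + t^2)] is split into a power of [t], which gives the
    logarithm of the theorem, and a power of [b], whose logarithm is traded for an
    integrable singularity by [ln (1 + s) <= s]. *)
Lemma ln1DV_le (t b : R) : 0 < t -> 0 < b ->
  ln (1 + (b / (1 + t ^+ 2))^-1) <= 2 * ln (t + 2) + 2 / Num.sqrt b.
Proof.
move=> t0 b0.
have s0 : 0 < Num.sqrt b by rewrite sqrtr_gt0.
have sV : 0 < (Num.sqrt b)^-1 by rewrite invr_gt0.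
set s := (Num.sqrt b)^-1 in sV *.
have bE : b^-1 = s ^+ 2 by rewrite /s exprVn sqr_sqrtr ?(ltW b0).
have -> : (b / (1 + t ^+ 2))^-1 = (1 + t ^+ 2) * s ^+ 2.
  by rewrite invf_div bE.
have le1 : 1 + (1 + t ^+ 2) * s ^+ 2 <= (t + 2) ^+ 2 * (1 + s) ^+ 2 by nra.
have p1 : 0 < 1 + (1 + t ^+ 2) * s ^+ 2 by nra.
have p2 : 0 < (t + 2) ^+ 2 * (1 + s) ^+ 2.
  by rewrite mulr_gt0 // exprn_gt0 //; lra.
apply: (@le_trans _ _ (ln ((t + 2) ^+ 2 * (1 + s) ^+ 2))).
  by rewrite ler_ln ?posrE.
rewrite lnM ?posrE ?exprn_gt0 //; try lra.
rewrite !lnXn; try lra.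
have := @le_ln1Dx _ s; rewrite -!(mulr_natl (ln _)) => h.
by have {}h : ln (1 + s) <= s by [apply: h; lra]; lra.
Qed.

(** Completing the square in [x], [M^2 = (1 + t^2) ((x - p)^2 + a^2)], so that
    [1 / M] is of size [1 / (t (|x - p| + a))]. The weight [1 / sqrt (1 + x^2)] left
    over from [jap2 ^ 3] makes its tail integrable, by [u v <= u^2 + v^2]. *)
Lemma jap2_shear_le (t x y a p : R) : 0 < t -> y != 0 ->
  a = `|y| / (1 + t ^+ 2) -> p = t * y / (1 + t ^+ 2) ->
  (jap2 (x, y) ^+ 3 * shear_norm t (x, y))^-1 <=
  2 / t * (1 + `|y - 0| ^+ 2)^-1 *
  (((`|x - p| + a) * (`|x - p| + a + 1))^-1 +
   ((1 + `|x - 0| ^+ 2)^-1 + (1 + `|x - p| ^+ 2)^-1)).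
Proof.
move=> t0 y0 aD pD.
have T0 : 0 < 1 + t ^+ 2 by nra.
have a0 : 0 < a by rewrite aD divr_gt0 // normr_gt0.
set s := `|x - p|; have s0 : 0 <= s by exact: normr_ge0.
rewrite !subr0 (real_normK (num_real x)) (real_normK (num_real y)).
have sE : s ^+ 2 = (x - p) ^+ 2 by rewrite real_normK ?num_real.
have aE : a ^+ 2 = y ^+ 2 / (1 + t ^+ 2) ^+ 2 by rewrite aD expr_div_n real_normK ?num_real.
have M2 : x ^+ 2 + (y - t * x) ^+ 2 = (1 + t ^+ 2) * (s ^+ 2 + a ^+ 2).
  by rewrite sE aE pD; field; rewrite gt_eqF.
have Mle : t * (s + a) / 2 <= shear_norm t (x, y).
  rewrite /shear_norm /= M2 -[leLHS]ger0_norm; last by rewrite divr_ge0 // mulr_ge0 //; lra.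
  by rewrite -sqrtr_sqr ler_sqrt; nra.
set X := Num.sqrt (1 + x ^+ 2).
have X2 : X ^+ 2 = 1 + x ^+ 2 by rewrite sqr_sqrtr //; nra.
have X1 : 1 <= X by rewrite -(sqrtr1 R) ler_sqrt; nra.
have J2 : jap2 (x, y) ^+ 2 = 1 + x ^+ 2 + y ^+ 2 by rewrite sqr_sqrtr //=; nra.
have JX : X <= jap2 (x, y) by rewrite ler_sqrt /=; nra.
have J3 : (1 + y ^+ 2) * X <= jap2 (x, y) ^+ 3.
  by rewrite (exprSr _ 2) J2; apply: ler_pM => //; nra.
have Y0 : 0 < 1 + y ^+ 2 by nra.
have sa : 0 < s + a by lra.
have -> : 2 / t * (1 + y ^+ 2)^-1 * (((s + a) * (s + a + 1))^-1 +
   ((1 + x ^+ 2)^-1 + (1 + s ^+ 2)^-1)) = 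
  ((1 + y ^+ 2) * (t / 2))^-1 * (((s + a) * (s + a + 1))^-1 +
   ((1 + x ^+ 2)^-1 + (1 + s ^+ 2)^-1)).
  by congr (_ * _); field; rewrite !gt_eqF.
apply: (@le_trans _ _ (((1 + y ^+ 2) * (t / 2))^-1 * (X * (s + a))^-1)).
  rewrite -invfM lef_pV2 ?posrE.
  - have -> : (1 + y ^+ 2) * (t / 2) * (X * (s + a)) =
      ((1 + y ^+ 2) * X) * (t * (s + a) / 2) by field.
    apply: ler_pM => //; first by rewrite mulr_ge0 //; lra.
    by rewrite divr_ge0 // mulr_ge0 //; lra.
  - rewrite mulr_gt0 // ?exprn_gt0 //; first by lra.
    by apply: lt_le_trans Mle; rewrite divr_gt0 // mulr_gt0.
  - by rewrite !mulr_gt0 //; lra.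
rewrite ler_pM2l ?invr_gt0; last by rewrite !mulr_gt0 //; lra.
(* [1 / (s + a)] as an integrable singularity plus a bounded tail *)
have -> : (X * (s + a))^-1 = X^-1 * ((s + a) * (s + a + 1))^-1 + X^-1 * (s + a + 1)^-1.
  by field; rewrite !gt_eqF //; lra.
apply: lerD.
  by apply: ler_piMl; [rewrite invr_ge0; nra|rewrite invf_le1; lra].
have le2 : (s + a + 1)^-1 ^+ 2 <= (1 + s ^+ 2)^-1.
  by rewrite exprVn lef_pV2 ?posrE; nra.
have XV : X^-1 ^+ 2 = (1 + x ^+ 2)^-1 by rewrite exprVn X2.
have p1 : 0 < X^-1 by rewrite invr_gt0; lra.
have p2 : 0 < (s + a + 1)^-1 by rewrite invr_gt0; lra.
by rewrite -XV; nra.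
Qed.

End PlaneWeights.

Section ShearIntegrals.
Context {R : realType}.
Local Notation mu := (@lebesgue_measure R).

Lemma cauchy_bound (p : R) : integral_bound mu (fun x => (1 + `|x - p| ^+ 2)^-1) 8.
Proof.
by have [mf fc] := integral_cauchy_le p; split.
Qed.

Lemma log_kernel_bound (a p : R) : 0 < a ->
  integral_bound mu (fun x => ((`|x - p| + a) * (`|x - p| + a + 1))^-1) (4 * ln (1 + a^-1)).
Proof.
move=> a0; have [mf fc] := integral_log_kernel_le p a0; split => // x.
by rewrite invr_ge0 mulr_ge0 ?addr_ge0 // ltW.
Qed.

Lemma measurable_jap2 : measurable_fun setT (@jap2 R).
Proof. by rewrite /jap2; measurability. Qed.

Lemma measurable_shear_norm (t : R) : measurable_fun setT (shear_norm t).
Proof. by rewrite /shear_norm; measurability. Qed.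

(** Integrate [jap2_shear_le] first in [x], where the logarithmic kernel yields
    [ln (1 + 1 / a)], and then in [y]. *)
Lemma shear_integral_bound (t : R) : 0 < t ->
  integral_bound mu2 (fun k : R * R => (jap2 k ^+ 3 * shear_norm t k)^-1)
    (1664 * (ln (t + 2) / t)).
Proof.
move=> t0; have L0 := ln_ge_half (ltW t0); set L := ln (t + 2) in L0 *.
have tV : 0 < t^-1 by rewrite invr_gt0.
apply: (@tonelli_bound _ _ (fun y : R => 2 / t *
   ((8 * L + 16) * (1 + `|y - 0| ^+ 2)^-1 + 16 * rsqrt_weight y))).
- apply: (measurableT_comp measurable_inv); apply: measurable_funM.
    by apply: measurable_funX; exact: measurable_jap2.
  exact: measurable_shear_norm.
- by move=> k; rewrite invr_ge0 mulr_ge0 ?exprn_ge0 ?sqrtr_ge0.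
- move=> y y0; have ny0 : 0 < `|y| by rewrite normr_gt0.
  pose a := `|y| / (1 + t ^+ 2); pose p := t * y / (1 + t ^+ 2).
  have a0 : 0 < a by rewrite divr_gt0 //; nra.
  apply: (@integral_bound_weaken _ _ _ mu _ (2 / t * (1 + `|y - 0| ^+ 2)^-1 *
     (4 * ln (1 + a^-1) + (8 + 8)))).
    rewrite -mulrA; apply: ler_wpM2l; first by rewrite mulr_ge0 // ltW.
    have h := ln1DV_le t0 ny0; rewrite -/a -/L in h.
    have sy0 : 0 < Num.sqrt `|y| by rewrite sqrtr_gt0.
    have q0 : 0 < 1 + `|y - 0| ^+ 2 by rewrite ltr_pwDl // sqr_ge0.
    have : (1 + `|y - 0| ^+ 2)^-1 * (8 / Num.sqrt `|y|) <= 16 * rsqrt_weight y.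
      rewrite subr0 /rsqrt_weight invfM.
      have -> : (1 + `|y| ^+ 2)^-1 * (8 / Num.sqrt `|y|) =
        8 * (Num.sqrt `|y|)^-1 * (1 + `|y| ^+ 2)^-1 by ring.
      have -> : 16 * ((Num.sqrt `|y|)^-1 / (1 + `|y|)) =
        8 * (Num.sqrt `|y|)^-1 * (2 / (1 + `|y|)) by ring.
      apply: ler_wpM2l; first by rewrite mulr_ge0 // invr_ge0 ltW.
      rewrite ler_pdivlMr; last by rewrite addr_gt0.
      rewrite mulrC ler_pdivrMr; nra.
    have qV : 0 < (1 + `|y - 0| ^+ 2)^-1 by rewrite invr_gt0.
    move=> wle; set q := (1 + `|y - 0| ^+ 2)^-1 in qV wle *.
    apply: (@le_trans _ _ (q * (8 * L + 16) + q * (8 / Num.sqrt `|y|))).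
      rewrite -mulrDr; apply: ler_wpM2l; [exact: ltW|].
      by rewrite (_ : 8 / Num.sqrt `|y| = 4 * (2 / Num.sqrt `|y|)); [lra|ring].
    by rewrite [q * _]mulrC; apply: lerD.
  apply: (@integral_bound_le _ _ _ mu _ (fun x : R => 2 / t * (1 + `|y - 0| ^+ 2)^-1 *
    (((`|x - p| + a) * (`|x - p| + a + 1))^-1 +
     ((1 + `|x - 0| ^+ 2)^-1 + (1 + `|x - p| ^+ 2)^-1)))).
  + apply: (measurableT_comp measurable_inv); rewrite /jap2 /shear_norm /=; measurability.
  + by move=> x; rewrite invr_ge0 mulr_ge0 ?exprn_ge0 ?sqrtr_ge0.
  + by apply: aeW => x; exact: jap2_shear_le.
  + apply: integral_boundZ.
      by rewrite mulr_ge0 ?invr_ge0 ?addr_ge0 ?sqr_ge0 // divr_ge0 // ltW.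
    apply: integral_boundD; first exact: log_kernel_bound.
    by apply: integral_boundD; exact: cauchy_bound.
- have := integral_boundZ (c := 16) _ rsqrt_weight_bound.
  have := integral_boundZ (c := 8 * L + 16) _ (cauchy_bound 0).
  move=> /(_ _)/[swap]/(_ _) h1 h2.
  apply: (@integral_bound_weaken _ _ _ mu _ (2 / t * ((8 * L + 16) * 8 + 16 * 16))).
    have -> : 1664 * (L / t) = 2 / t * (832 * L) by ring.
    by apply: ler_wpM2l; [rewrite mulr_ge0 // ltW|lra].
  apply: integral_boundZ; first by rewrite mulr_ge0 // ltW.
  by apply: integral_boundD; [apply: h2; lra|apply: h1].
Qed.

(** In the first variable this is a Poisson kernel of mass [pi / t], whatever [y]. *)
Lemma poisson_integral_bound (t : R) : 0 < t ->
  integral_bound mu2 (fun k : R * R =>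
    `|k.2| * (k.2 ^+ 2 + t ^+ 2 * k.1 ^+ 2)^-1 * (1 + k.2 ^+ 2)^-1) (64 / t).
Proof.
move=> t0.
apply: (@tonelli_bound _ _ (fun y : R => 8 / t * (1 + `|y - 0| ^+ 2)^-1)).
- apply: measurable_funM; last first.
    by apply: (measurableT_comp measurable_inv); measurability.
  apply: measurable_funM; first by measurability.
  by apply: (measurableT_comp measurable_inv); measurability.
- move=> k; apply: mulr_ge0; last by rewrite invr_ge0 addr_ge0 // sqr_ge0.
  by apply: mulr_ge0 => //; rewrite invr_ge0 addr_ge0 ?sqr_ge0 //; apply: mulr_ge0; exact: sqr_ge0.
- move=> y y0 /=; have ny0 : 0 < `|y| by rewrite normr_gt0.
  rewrite subr0 mulrC (real_normK (num_real y)); under eq_fun do rewrite mulrC.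
  apply: integral_boundZ; first by rewrite invr_ge0 addr_ge0 // sqr_ge0.
  have [mf fc] := integral_poisson_kernel_le ny0 t0.
  rewrite (real_normK (num_real y)) in mf fc; split => // x.
  by rewrite divr_ge0 // addr_ge0 ?sqr_ge0 //; apply: mulr_ge0; exact: sqr_ge0.
- have -> : 64 / t = 8 / t * 8 by ring.
  by apply: integral_boundZ; [rewrite divr_ge0 // ltW|exact: cauchy_bound].
Qed.
End ShearIntegrals.

(** * The phase and its radial derivatives *)

Section Symbols.
Context {R : realType}.
Variables (t z y alpha : R).
Hypothesis t0 : 0 < t.
Implicit Types k : R * R.

Definition linear_phase k := k.1 * z + k.2 * y.
Definition total_phase k := linear_phase k + phase t k + alpha.
(** Where this ratio equals 1 the phase is stationary along rays. *)
Definition phase_ratio k := linear_phase k * (phase t k)^-1.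

Lemma phase_neq0 k : k.1 != 0 -> phase t k != 0.
Proof.
move=> k0; rewrite mulf_neq0 ?invr_eq0 // gt_eqF //.
apply: lt_le_trans (atan_sum_ge _ t0); rewrite divr_gt0 // mulr_gt0 // sqrtr_gt0;
  by rewrite ltr_pwDl // sqr_ge0.
Qed.

Lemma radial_slope : radial_derivative (fun k : R * R => k.2 / k.1) (fun=> 0).
Proof.
have h := radial_derivativeM (@radial_derivative_snd R)
  (radial_derivativeV (@radial_derivative_fst R) (fun k hk => hk)).
apply: eq_radial_derivative h => k k0; field; exact: k0.
Qed.

(** The slope is constant along rays, so only the factor [1 / k.1] contributes. *)
Lemma radial_phase : radial_derivative (phase t) (fun k => - phase t k).
Proof.
have hV := radial_derivativeV (@radial_derivative_fst R) (fun k hk => hk).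
have h1 := radial_derivativeD (radial_derivative_cst t) (radial_derivativeN radial_slope).
have dat x : is_derive x (1 : R) (@atan R) (1 + x ^+ 2)^-1 by exact: is_derive1_atan.
have cat (x : R) : {for x, continuous (fun x : R => (1 + x ^+ 2)^-1)}.
  apply: cvgV; first by rewrite gt_eqF // ltr_pwDl // sqr_ge0.
  by apply: cvgD; [exact: cvg_cst|exact: exprn_continuous].
have h2 := radial_derivative_comp (h := @atan R) h1 (fun k _ => dat _) (fun k _ => cat _).
have h3 := radial_derivative_comp (h := @atan R) radial_slope (fun k _ => dat _) (fun k _ => cat _).
have h4 := radial_derivativeM hV (radial_derivativeD h2 h3).
apply: eq_radial_derivative h4 => k k0; rewrite /phase oppr0 !(mulr0, addr0); field; exact: k0.
Qed.

Lemma radial_linear_phase : radial_derivative linear_phase linear_phase.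
Proof.
have h1 := radial_derivativeM (@radial_derivative_fst R) (radial_derivative_cst z).
have h2 := radial_derivativeM (@radial_derivative_snd R) (radial_derivative_cst y).
apply: eq_radial_derivative (radial_derivativeD h1 h2) => k _.
by rewrite /linear_phase; ring.
Qed.

Lemma radial_sin_total_phase :
  radial_derivative (fun k => sin (total_phase k))
    (fun k => cos (total_phase k) * (linear_phase k - phase t k)).
Proof.
have h := radial_derivativeD (radial_derivativeD radial_linear_phase radial_phase)
  (radial_derivative_cst alpha).
have ds (x : R) : is_derive x (1 : R) sin (cos x) by exact: is_derive_sin.
have h2 := radial_derivative_comp (h := sin) h (fun k _ => ds _)
  (fun k _ => @continuous_cos R _).
by apply: eq_radial_derivative h2 => k _; rewrite addr0.
Qed.

Lemma radial_phase_ratio : radial_derivative phase_ratio (fun k => 2 * phase_ratio k).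
Proof.
have h := radial_derivativeM radial_linear_phase (radial_derivativeV radial_phase phase_neq0).
apply: eq_radial_derivative h => k /phase_neq0 p0; rewrite /phase_ratio; field; exact: p0.
Qed.

(** The multiplier [q] of the decomposition [1 = (1 - r) q(r) + 2 r / (1 + r^2)]. Its
    decay at infinity keeps [q] and [r q'(r)] bounded, which is what replaces a
    cut-off around the stationary set. *)
Definition damping (x : R) : R := (1 - x) / (1 + x ^+ 2).
Definition damping' (x : R) : R := (x ^+ 2 - 2 * x - 1) / (1 + x ^+ 2) ^+ 2.

Lemma is_derive_damping (x : R) : is_derive x (1 : R) damping (damping' x).
Proof.
have q0 : 1 + x ^+ 2 != 0 by rewrite gt_eqF // ltr_pwDl // sqr_ge0.
have d1 : is_derive x (1 : R) (fun x : R => 1 - x) (0 - 1).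
  exact: is_deriveB.
have dX : is_derive x (1 : R) ((id : R -> R) ^+ 2) (2 * x).
  by apply: (is_derive_eq (is_deriveX _ _)); rewrite /GRing.scale /=; ring.
have d2 : is_derive x (1 : R) (fun x : R => 1 + x ^+ 2) (0 + 2 * x) :=
  is_deriveD (is_derive_cst (1 : R) x 1) dX.
have d3 := is_deriveM d1 (@is_deriveV R (fun x : R => 1 + x ^+ 2) x _ 1 q0 d2).
apply: (is_derive_eq d3); rewrite /GRing.scale /= /damping'; field; exact: q0.
Qed.

Lemma continuous_damping' : continuous damping'.
Proof.
move=> x; have q0 : 1 + x ^+ 2 != 0 by rewrite gt_eqF // ltr_pwDl // sqr_ge0.
have cx : (fun y : R => y ^+ 2) @ x --> x ^+ 2 by exact: exprn_continuous.
have ci : (fun y : R => y) @ x --> x by exact: cvg_id.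
apply: cvgM.
  apply: cvgB; last exact: cvg_cst.
  by apply: cvgB => //; apply: cvgM => //; exact: cvg_cst.
apply: cvgV; first by rewrite expf_neq0.
have c1 : (fun y : R => 1 + y ^+ 2) @ x --> 1 + x ^+ 2 by apply: cvgD => //; exact: cvg_cst.
exact: (cvgM c1 c1).
Qed.

Lemma norm_damping_le (x : R) : `|damping x| <= 2.
Proof.
have q0 : 0 < 1 + x ^+ 2 by rewrite ltr_pwDl // sqr_ge0.
rewrite ler_norml /damping; apply/andP; split.
  by rewrite ler_pdivlMr //; nra.
by rewrite ler_pdivrMr //; nra.
Qed.

Lemma norm_damping'_le (x : R) : `|damping' x * (2 * x)| <= 2.
Proof.
have q0 : 0 < (1 + x ^+ 2) ^+ 2 by rewrite exprn_gt0 // ltr_pwDl // sqr_ge0.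
have -> : damping' x * (2 * x) = (x ^+ 2 - 2 * x - 1) * (2 * x) / (1 + x ^+ 2) ^+ 2.
  by rewrite /damping'; ring.
rewrite ler_norml; apply/andP; split.
  rewrite ler_pdivlMr // -subr_ge0.
  have -> : (x ^+ 2 - 2 * x - 1) * (2 * x) - -2 * (1 + x ^+ 2) ^+ 2 =
    (x ^+ 2 + x - 1) ^+ 2 + (x ^+ 2) ^+ 2 + 1 + x ^+ 2 by ring.
  by rewrite !addr_ge0 ?sqr_ge0.
rewrite ler_pdivrMr // -subr_ge0.
have -> : 2 * (1 + x ^+ 2) ^+ 2 - (x ^+ 2 - 2 * x - 1) * (2 * x) =
    (x ^+ 2 - x) ^+ 2 + x ^+ 4 + 7 * x ^+ 2 + 2 * x + 2 by ring.
have := sqr_ge0 (x ^+ 2 - x); have := sqr_ge0 (x ^+ 2); have := sqr_ge0 (x + 1);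
  have := sqr_ge0 x.
rewrite -[x ^+ 4]/(x ^+ (2 * 2)) exprM; nra.
Qed.

End Symbols.

(** * Boundedness and measurability of test functions *)

Section TestFunctions.
Context {R : realType}.
Implicit Types (f psi G : R * R -> R) (k v : R * R).

(** Compactness of the square. *)
Lemma bounded_of_support f n : continuous f -> (forall k, ~ box n k -> f k = 0) ->
  exists B, forall k, `|f k| <= B.
Proof.
move=> cf fn.
pose A : set (R * R) := `[- n%:R, n%:R] `*` `[- n%:R, n%:R].
have AE k : box n k -> A k.
  by rewrite /box /A /= !in_itv /= !ler_norml.
have A0 : A !=set0.
  by exists (0, 0); rewrite /A /= !in_itv /= !oppr_le0 !ler0n.
have cA : compact A by apply: compact_setX; exact: segment_compact.
have cg : {within A, continuous (fun k => `|f k|)}.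
  apply: continuous_subspaceT => k.
  apply: (@continuous_comp _ _ _ f Num.norm); [exact: cf|exact: norm_continuous].
have [c _ cmax] := compact_EVT_max A0 cA cg.
exists `|f c| => k; have [kn|kn] := pselect (box n k).
  by apply: cmax; rewrite inE; exact: AE.
by rewrite fn // normr0.
Qed.

Lemma open_box_compl n : open (~` box n : set (R * R)).
Proof.
apply: closed_openC; rewrite (_ : box n = (fun k : R * R => `|k.1|) @^-1` [set x | x <= n%:R] `&`
  (fun k : R * R => `|k.2|) @^-1` [set x | x <= n%:R]) //.
have c1 : continuous (fun k : R * R => `|k.1|).
  by move=> k; apply: cvg_norm; exact: cvg_fst.
have c2 : continuous (fun k : R * R => `|k.2|).
  by move=> k; apply: cvg_norm; exact: cvg_snd.
apply: closedI.
  by apply: closed_comp; [move=> ? _; exact: c1|exact: closed_le].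
by apply: closed_comp; [move=> ? _; exact: c2|exact: closed_le].
Qed.

Lemma test_function_derive_bounded psi v : test_function psi ->
  exists B, forall k, `|'D_v psi k| <= B.
Proof.
move=> [dpsi cpsi [n psin]]; apply: (@bounded_of_support _ n) => // k kn.
have psi0 : \forall x \near k, psi x = 0.
  have : nbhs k (~` box n : set (R * R)).
    by apply: open_nbhs_nbhs; split => //; exact: open_box_compl.
  by apply: filterS => x; exact: psin.
have df := is_diff_near0 psi0.
by rewrite deriveE // diff_val.
Qed.

Lemma test_function_bounded psi : test_function psi -> exists B, forall k, `|psi k| <= B.
Proof.
move=> [dpsi _ [n psin]]; apply: (@bounded_of_support _ n) => // k.
exact: differentiable_continuous.
Qed.

(** A directional derivative is the pointwise limit of difference quotients along
    the steps [1 / (n + 1)]. *)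
Lemma measurable_derive f v : measurable_fun setT f ->
  (forall k, derivable f k v) -> measurable_fun setT (fun k => 'D_v f k).
Proof.
move=> mf df.
pose h (n : nat) k := n.+1%:R * (f (n.+1%:R^-1 * v.1 + k.1, n.+1%:R^-1 * v.2 + k.2) - f k).
apply: (@measurable_fun_cvg _ _ _ _ h) => [n|k _].
  apply: measurable_funM; first exact: measurable_cst.
  apply: measurable_funB => //; apply: (measurableT_comp mf).
  by apply: measurable_fun_pair; measurability.
have := df k; rewrite /derivable => /cvg_ex[l hl].
have -> : 'D_v f k = l by apply: cvg_lim.
have hn : (fun n => @harmonic R n) @ \oo --> 0^'.
  move=> A; rewrite /dnbhs /within /= => hA.
  have := @cvg_harmonic R _ hA; rewrite /nbhs /=; apply: filterS => n /=; apply.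
  by rewrite invr_eq0 pnatr_eq0.
apply: cvg_trans (cvg_comp _ _ hn hl).
apply: near_eq_cvg; apply: nearW => n /=; rewrite /h /= invrK /GRing.scale /=.
by [].
Qed.

Context {d : measure_display} {T : measurableType d}.
Variable m : {measure set T -> \bar R}.

Lemma Rintegral_norm_le (f g : T -> R) c : measurable_fun setT f ->
  {ae m, forall x, `|f x| <= g x} -> integral_bound m g c ->
  m.-integrable setT (EFin \o f) /\ `|Rintegral m setT f| <= c.
Proof.
move=> mf fg gc.
have [mnf _ nc] : integral_bound m (fun x => `|f x|) c.
  by apply: integral_bound_le fg gc => //; apply: measurableT_comp.
have fi : m.-integrable setT (EFin \o f).
  apply/integrableP; split; first exact/measurable_EFinP.
  by apply: le_lt_trans nc _; rewrite ltry.
split => //; rewrite -lee_fin EFin_normr_Rintegral //.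
exact: le_trans (le_abse_integral m measurableT (measurable_int _ fi)) nc.
Qed.

Lemma integrable_bounded_mul (f g : T -> R) B : measurable_fun setT f ->
  (forall x, `|f x| <= B) -> m.-integrable setT (EFin \o g) ->
  m.-integrable setT (EFin \o (fun x => f x * g x)).
Proof.
move=> mf fB gi.
have mg : measurable_fun setT g by apply/measurable_EFinP; exact: measurable_int gi.
apply: (le_integrable measurableT _ _ (integrableZl measurableT B gi)).
  by apply/measurable_EFinP; exact: measurable_funM.
move=> x _ /=; rewrite lee_fin !normrM ler_wpM2r //.
by rewrite (le_trans (fB x)) // ler_norm.
Qed.
End TestFunctions.

(** * Integration by parts along rays *)

Section WeakDivergence.
Context {R : realType}.
Implicit Types (f d G psi : R * R -> R) (k : R * R).
Local Notation mu := (@lebesgue_measure R).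

Lemma ae_offaxis : {ae mu2, forall k, k.1 != 0}.
Proof.
exists ([set 0] `*` setT); split.
- exact: measurableX.
- rewrite /mu2 product_measure1E //.
  by rewrite [X in (X * _)%E]lebesgue_measure_set1 mul0e.
- by move=> k /= /negP; rewrite negbK => /eqP.
Qed.

Definition weak_gradient G G1 G2 : Prop := forall psi, test_function psi ->
  Rintegral mu2 setT (fun k => 'D_(1, 0) psi k * G k) =
    - Rintegral mu2 setT (fun k => psi k * G1 k) /\
  Rintegral mu2 setT (fun k => 'D_(0, 1) psi k * G k) =
    - Rintegral mu2 setT (fun k => psi k * G2 k).

(** The weak gradient tested against the field [f k]: the function [W] is the
    divergence of [G f k], which integrates to 0. *)
Lemma weak_radial_divergence G G1 G2 f d eps n : weak_gradient G G1 G2 ->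
  mu2.-integrable setT (EFin \o G) ->
  mu2.-integrable setT (EFin \o G1) -> mu2.-integrable setT (EFin \o G2) ->
  measurable_fun setT f -> radial_derivative f d ->
  0 < eps -> (forall k, `|k.1| < eps -> f k = 0) -> (forall k, ~ box n k -> f k = 0) ->
  exists W, [/\ mu2.-integrable setT (EFin \o W), Rintegral mu2 setT W = 0 &
    forall k, k.1 != 0 ->
      W k = (d k + 2 * f k) * G k + f k * (k.1 * G1 k + k.2 * G2 k)].
Proof.
move=> wG iG iG1 iG2 mf rf eps0 feps fn.
pose f1 k := f k * k.1; pose f2 k := f k * k.2.
have t1 : test_function f1.
  apply: (@radial_derivative_test _ _ _ eps n (radial_derivativeM rf radial_derivative_fst) eps0).
    by move=> k /feps ->; rewrite mul0r.
  by move=> k /fn ->; rewrite mul0r.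
have t2 : test_function f2.
  apply: (@radial_derivative_test _ _ _ eps n (radial_derivativeM rf radial_derivative_snd) eps0).
    by move=> k /feps ->; rewrite mul0r.
  by move=> k /fn ->; rewrite mul0r.
have m1 : measurable_fun setT f1 by rewrite /f1; measurability.
have m2 : measurable_fun setT f2 by rewrite /f2; measurability.
have [[d1 _ _] [d2 _ _]] := (t1, t2).
have i1 : mu2.-integrable setT (EFin \o (fun k => 'D_(1, 0) f1 k * G k)).
  have [B fB] := test_function_derive_bounded (1, 0) t1.
  have mD : measurable_fun setT (fun k => 'D_(1, 0) f1 k).
    by apply: measurable_derive => // k; exact: diff_derivable.
  by apply: (@integrable_bounded_mul R _ _ mu2 _ G B _ fB iG).
have i2 : mu2.-integrable setT (EFin \o (fun k => 'D_(0, 1) f2 k * G k)).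
  have [B fB] := test_function_derive_bounded (0, 1) t2.
  have mD : measurable_fun setT (fun k => 'D_(0, 1) f2 k).
    by apply: measurable_derive => // k; exact: diff_derivable.
  by apply: (@integrable_bounded_mul R _ _ mu2 _ G B _ fB iG).
have i3 : mu2.-integrable setT (EFin \o (fun k => f1 k * G1 k)).
  by have [B fB] := test_function_bounded t1; apply: (@integrable_bounded_mul R _ _ mu2 f1 G1 B _ fB iG1).
have i4 : mu2.-integrable setT (EFin \o (fun k => f2 k * G2 k)).
  by have [B fB] := test_function_bounded t2; apply: (@integrable_bounded_mul R _ _ mu2 f2 G2 B _ fB iG2).
pose W12 k := 'D_(1, 0) f1 k * G k + 'D_(0, 1) f2 k * G k.
pose W34 k := f1 k * G1 k + f2 k * G2 k.
have i12 : mu2.-integrable setT (EFin \o W12) by exact: (integrableD measurableT i1 i2).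
have i34 : mu2.-integrable setT (EFin \o W34) by exact: (integrableD measurableT i3 i4).
exists (fun k => W12 k + W34 k); split.
- exact: (integrableD measurableT i12 i34).
- rewrite RintegralD // /W12 /W34 !RintegralD //.
  by have [-> _] := wG _ t1; have [_ ->] := wG _ t2; ring.
- move=> k k0; rewrite /W12 /W34 -mulrDl.
  by rewrite (radial_divergence rf k0) /f1 /f2; ring.
Qed.
End WeakDivergence.

Section Cutoff.
Context {R : realType}.
Implicit Types (k : R * R).

(** The gauge tends to infinity at the axis and at infinity, and its radial
    derivative is at most twice the gauge; both follow from the homogeneity of its
    terms. *)
Definition cutoff_gauge k : R := k.1^-1 ^+ 2 + (k.1 ^+ 2 + k.2 ^+ 2).
Definition cutoff (n : nat) k : R := ramp2 (1 - cutoff_gauge k / n.+1%:R).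
Definition cutoff' (n : nat) k : R :=
  2 * Num.max 0 (1 - cutoff_gauge k / n.+1%:R) *
  (- (2 * (k.1 ^+ 2 + k.2 ^+ 2 - k.1^-1 ^+ 2) / n.+1%:R)).

Lemma cutoff_gauge_ge0 k : 0 <= cutoff_gauge k.
Proof. by rewrite !addr_ge0 ?sqr_ge0. Qed.

Lemma radial_cutoff n : radial_derivative (cutoff n) (cutoff' n).
Proof.
have hV := radial_derivativeV (@radial_derivative_fst R) (fun k hk => hk).
have h1 := @radial_derivative_fst R; have h2 := @radial_derivative_snd R.
have hF := radial_derivativeD (radial_derivativeM hV hV)
  (radial_derivativeD (radial_derivativeM h1 h1) (radial_derivativeM h2 h2)).
have hA := radial_derivativeD (radial_derivative_cst 1)
  (radial_derivativeN (radial_derivativeM hF (radial_derivative_cst n.+1%:R^-1))).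
have h := radial_derivative_comp hA (fun k _ => is_derive_ramp2 _)
  (fun k _ => @continuous_ramp2' R _).
apply: eq_radial_derivative h => k k0; rewrite /cutoff'.
have : n.+1%:R != 0 :> R by rewrite pnatr_eq0.
set N := n.+1%:R => N0; congr (_ * _).
by field; rewrite nat1r -/N N0; exact: k0.
Qed.

Lemma ramp2_ge0_le1 (x : R) : x <= 1 -> 0 <= ramp2 x <= 1.
Proof.
move=> x1; rewrite /ramp2 sqr_ge0 /= expr_le1 // ?le_max ?lexx //.
by rewrite ge_max ler01.
Qed.

Lemma norm_cutoff_le1 n k : `|cutoff n k| <= 1.
Proof.
have /andP[c0 c1] : 0 <= cutoff n k <= 1.
  by apply: ramp2_ge0_le1; rewrite gerBl divr_ge0 // cutoff_gauge_ge0.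
by rewrite ger0_norm.
Qed.

(** With [x] the rescaled gauge, the derivative is at most [4 x (1 - x) <= 1]. *)
Lemma norm_cutoff'_le1 n k : `|cutoff' n k| <= 1.
Proof.
rewrite /cutoff'; set N := n.+1%:R; have N0 : 0 < N by rewrite ltr0Sn.
have F0 := cutoff_gauge_ge0 k; set F := cutoff_gauge k in F0 *.
have x0 : 0 <= F / N by rewrite divr_ge0 // ltW.
set D := _ - k.1^-1 ^+ 2.
have DF : `|D| <= F.
  have a1 := sqr_ge0 k.1; have a2 := sqr_ge0 k.2; have a3 := sqr_ge0 k.1^-1.
  by rewrite /D /F /cutoff_gauge ler_norml; apply/andP; split; lra.
rewrite normrM normrN.
have -> : `|2 * D / N| = 2 * `|D| / N by rewrite !normrM normfV (gtr0_norm N0) ger0_norm.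
have le1 : 2 * `|D| / N <= 2 * (F / N).
  by rewrite mulrA ler_pM2r ?invr_gt0 // ler_pM2l.
have m0 : 0 <= 2 * Num.max 0 (1 - F / N) by rewrite mulr_ge0 // le_max lexx.
rewrite (ger0_norm m0); apply: (le_trans (ler_wpM2l m0 le1)).
set x := F / N in x0 *; rewrite /Num.max; case: ifP => h; last by rewrite mulr0 mul0r.
have := sqr_ge0 (2 * x - 1); nra.
Qed.

Lemma cutoff_eq0 n k : n.+1%:R <= cutoff_gauge k -> cutoff n k = 0.
Proof.
move=> h; rewrite /cutoff /ramp2 (max_idPl _) ?expr0n //.
by rewrite subr_le0 ler_pdivlMr // mul1r.
Qed.

Lemma cutoff_near_axis n k : k.1 != 0 -> `|k.1| < n.+1%:R^-1 -> cutoff n k = 0.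
Proof.
move=> k0 kn; apply: cutoff_eq0; rewrite /cutoff_gauge.
have N1 : 1 <= n.+1%:R :> R by rewrite ler1n.
have : n.+1%:R <= `|k.1|^-1 by rewrite -[leLHS]invrK lef_pV2 ?posrE ?normr_gt0 ?invr_gt0 // ltW.
rewrite -(real_normK (num_real k.1^-1)) normfV.
by have := sqr_ge0 k.1; have := sqr_ge0 k.2; set N := n.+1%:R in N1 *; set x := `|k.1|^-1; nra.
Qed.

Lemma cutoff_off_box n k : ~ box n.+1 k -> cutoff n k = 0.
Proof.
move=> kn; apply: cutoff_eq0; rewrite /cutoff_gauge.
have N1 : 1 <= n.+1%:R :> R by rewrite ler1n.
rewrite -(real_normK (num_real k.1)) -(real_normK (num_real k.2)).
have := sqr_ge0 `|k.1|; have := sqr_ge0 `|k.2|; have := sqr_ge0 k.1^-1.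
have [k1|k1] := leP `|k.1| n.+1%:R; last by set N := n.+1%:R in N1 k1 *; nra.
have [k2|k2] := leP `|k.2| n.+1%:R; last by set N := n.+1%:R in N1 k2 *; nra.
by exfalso; apply: kn.
Qed.

Lemma cutoff_cvg k : (fun n => cutoff n k) @ \oo --> (1 : R).
Proof.
have h1 : (fun n => 1 - cutoff_gauge k / n.+1%:R) @ \oo --> (1 : R).
  rewrite -[X in _ --> X]subr0 -(mulr0 (cutoff_gauge k)); apply: cvgB; first exact: cvg_cst.
  by apply: cvgM; [exact: cvg_cst|exact: cvg_harmonic].
have h2 : {for (1 : R), continuous (@ramp2 R)}.
  have [/derivable1_diffP df _] := is_derive_ramp2 (1 : R).
  exact: differentiable_continuous.
have := continuous_cvg _ h2 h1; rewrite /ramp2 (max_idPr _) // expr1n; exact.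
Qed.
End Cutoff.

(** * The oscillatory integral bound *)

Section Oscillatory.
Context {R : realType}.
Implicit Types (k : R * R) (K G : R * R -> R).

Lemma jap2_ge1 k : 1 <= jap2 k.
Proof.
by rewrite /jap2 -[leLHS]sqrtr1 ler_sqrt -?addrA ?lerDl ?addr_ge0 ?sqr_ge0.
Qed.

Lemma jap2_gt0 k : 0 < jap2 k.
Proof. exact: lt_le_trans ltr01 (jap2_ge1 k). Qed.

Lemma jap2_sqr k : jap2 k ^+ 2 = 1 + k.1 ^+ 2 + k.2 ^+ 2.
Proof. by rewrite sqr_sqrtr // -addrA !addr_ge0 ?sqr_ge0. Qed.

Lemma norm_fst_jap2 k : `|k.1| <= jap2 k.
Proof.
rewrite -sqrtr_sqr ler_sqrt; last by rewrite -addrA !addr_ge0 ?sqr_ge0.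
by rewrite addrAC lerDr addr_ge0 // sqr_ge0.
Qed.

Lemma norm_snd_jap2 k : `|k.2| <= jap2 k.
Proof.
rewrite -sqrtr_sqr ler_sqrt; last by rewrite -addrA !addr_ge0 ?sqr_ge0.
by rewrite lerDr addr_ge0 // sqr_ge0.
Qed.

Lemma norm_linear_phase_le z y k :
  `|linear_phase z y k| <= Num.sqrt (z ^+ 2 + y ^+ 2) * jap2 k.
Proof.
rewrite -sqrtr_sqr -sqrtrM ?addr_ge0 ?sqr_ge0 // ler_sqrt; last first.
  by rewrite mulr_ge0 ?addr_ge0 ?sqr_ge0 // -addrA !addr_ge0 ?sqr_ge0.
rewrite /linear_phase; have := sqr_ge0 (k.1 * y - k.2 * z).
have := sqr_ge0 z; have := sqr_ge0 y; nra.
Qed.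

Lemma measurable_phase t : measurable_fun setT (phase t : R * R -> R).
Proof. by rewrite /phase; measurability. Qed.

Lemma measurable_total_phase t z y alpha :
  measurable_fun setT (total_phase t z y alpha : R * R -> R).
Proof.
have h := measurable_phase t.
by rewrite /total_phase /linear_phase; measurability.
Qed.

Lemma measurable_phase_ratio t z y :
  measurable_fun setT (phase_ratio t z y : R * R -> R).
Proof.
have h := measurable_phase t.
by rewrite /phase_ratio /linear_phase; measurability.
Qed.

Lemma measurable_damping : measurable_fun setT (@damping R).
Proof. by rewrite /damping; measurability. Qed.

Lemma measurable_cutoff n : measurable_fun setT (@cutoff R n).
Proof. by rewrite /cutoff /cutoff_gauge /ramp2; measurability. Qed.

Lemma ae_plane2 (P Q S : R * R -> Prop) : (forall k, P k -> Q k -> S k) ->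
  {ae mu2, forall k, P k} -> {ae mu2, forall k, Q k} -> {ae mu2, forall k, S k}.
Proof.
have F := @ae_filter_ringOfSetsType _ _ _ (@mu2 R : {measure set _ -> \bar R}).
by move=> PQS hP hQ; exact: (@filterS2 _ _ F _ _ _ PQS hP hQ).
Qed.

(** Stated for functions on the plane so that measurability may refer to the usual
    Borel sets of the factors, which are those of Lebesgue measure. *)
Lemma plane_Rintegral_le (f g : R * R -> R) (c : R) : measurable_fun setT f ->
  {ae mu2, forall k, `|f k| <= g k} -> integral_bound mu2 g c ->
  mu2.-integrable setT (EFin \o f) /\ `|Rintegral mu2 setT f| <= c.
Proof. by move=> mf fg gc; apply: (@Rintegral_norm_le R _ _ mu2 f g c _ fg gc). Qed.

Lemma ler_normM (a b c d : R) : `|a| <= c -> `|b| <= d -> `|a * b| <= c * d.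
Proof. by move=> ac bd; rewrite normrM ler_pM. Qed.

(** The terms produced by the integration by parts, in which [c], [S], [q], [H] are
    the cut-off, the sine of the phase, the damping and the quotient [K / Phi], the
    letters [c'] and [s] the radial derivatives of cut-off and damping, and [P] the
    radial derivative of [G]. *)
Lemma parts_integrand_le (c c' S q s H G P B : R) :
  `|c| <= 1 -> `|c'| <= 1 -> `|S| <= 1 -> `|q| <= 2 -> `|s| <= 2 ->
  `|G| <= B -> `|P| <= 2 * B ->
  `|(c' * (S * (q * H)) + c * (S * (s * H)) + 2 * (c * (S * (q * H)))) * G +
    c * (S * (q * H)) * P| <= 12 * (`|H| * B).
Proof.
move=> c1 c'1 S1 q2 s2 GB PB.
have -> : (c' * (S * (q * H)) + c * (S * (s * H)) + 2 * (c * (S * (q * H)))) * G +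
    c * (S * (q * H)) * P =
  S * (H * ((c' * q) * G + (c * s) * G + 2 * ((c * q) * G) + (c * q) * P)) by ring.
have -> : 12 * (`|H| * B) = 1 * (`|H| * (1 * 2 * B + 1 * 2 * B + 2 * (1 * 2 * B) + 1 * 2 * (2 * B))).
  by ring.
apply: ler_normM => //; apply: ler_normM => //.
have n2 : `|2 : R| <= 2 by rewrite ger0_norm.
do 3 (apply: (le_trans (ler_normD _ _)); apply: lerD; last by repeat apply: ler_normM).
by repeat apply: ler_normM.
Qed.

Variables (t z y alpha N E C : R) (K G G1 G2 : R * R -> R).
Hypothesis t0 : 0 < t.
Hypothesis N0 : 0 <= N.
Hypothesis mK : measurable_fun setT K.
Hypothesis rK : radial_derivative K (fun k => - K k).
Hypothesis bH : integral_bound mu2 (fun k => `|K k / phase t k| * (jap2 k ^+ 4)^-1) E.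
Hypothesis bK : integral_bound mu2 (fun k => `|K k| * (jap2 k ^+ 5)^-1) C.
Hypothesis wG : weak_gradient G G1 G2.
Hypothesis iG : mu2.-integrable setT (EFin \o G).
Hypothesis iG1 : mu2.-integrable setT (EFin \o G1).
Hypothesis iG2 : mu2.-integrable setT (EFin \o G2).
Hypothesis bG : {ae mu2, forall k, `|G k| <= N * (jap2 k ^+ 5)^-1}.
Hypothesis bG1 : {ae mu2, forall k, `|G1 k| <= N * (jap2 k ^+ 6)^-1}.
Hypothesis bG2 : {ae mu2, forall k, `|G2 k| <= N * (jap2 k ^+ 6)^-1}.

Let T k := cos (total_phase t z y alpha k).
Let S k := sin (total_phase t z y alpha k).
Let r := phase_ratio t z y.
Let H k := K k / phase t k.
Let amp k := S k * (damping (r k) * H k).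

Let mT : measurable_fun setT T.
Proof. by have h := measurable_total_phase t z y alpha; rewrite /T; measurability. Qed.
Let mS : measurable_fun setT S.
Proof. by have h := measurable_total_phase t z y alpha; rewrite /S; measurability. Qed.
Let mr : measurable_fun setT r. Proof. exact: measurable_phase_ratio. Qed.
Let mq : measurable_fun setT (fun k => damping (r k)).
Proof. exact: (measurableT_comp measurable_damping mr). Qed.
Let mG : measurable_fun setT G.
Proof. by apply/measurable_EFinP; exact: measurable_int iG. Qed.

Let radial_quotient : radial_derivative H (fun=> 0).
Proof.
have h := radial_derivativeM rK (radial_derivativeV (radial_phase t) (phase_neq0 t0)).
apply: eq_radial_derivative h => k k0.
by have p0 := phase_neq0 t0 k0; field; exact: p0.
Qed.

Let amp' k := T k * (linear_phase z y k - phase t k) * (damping (r k) * H k) +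
  S k * (damping' (r k) * (2 * r k) * H k).

Let radial_amp : radial_derivative amp amp'.
Proof.
have hq := radial_derivative_comp (h := @damping R) (radial_phase_ratio z y t0)
  (fun k _ => is_derive_damping _) (fun k _ => @continuous_damping' R _).
have h := radial_derivativeM (radial_sin_total_phase t z y alpha)
  (radial_derivativeM hq radial_quotient).
by apply: eq_radial_derivative h => k _; rewrite mulr0 addr0.
Qed.

Let amp_axis k : k.1 = 0 -> amp k = 0.
Proof. by move=> k0; rewrite /amp /H /phase k0 invr0 mul0r invr0 !mulr0. Qed.

Let damped k := T k * K k * ((1 - r k) * damping (r k)) * G k.

Let gradient_le : {ae mu2, forall k, `|k.1 * G1 k + k.2 * G2 k| <= 2 * (N * (jap2 k ^+ 5)^-1)}.
Proof.
apply: ae_plane2 bG1 bG2 => k h1 h2.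
have J0 := jap2_gt0 k.
have e : jap2 k * (N * (jap2 k ^+ 6)^-1) = N * (jap2 k ^+ 5)^-1.
  by field; rewrite gt_eqF.
rewrite (le_trans (ler_normD _ _)) // !normrM mulr_natl mulr2n -e.
by apply: lerD; apply: ler_pM => //; [exact: norm_fst_jap2|exact: norm_snd_jap2].
Qed.

Let dominating_bound c : 0 <= c ->
  integral_bound mu2 (fun k => c * N * (`|H k| * (jap2 k ^+ 4)^-1)) (c * N * E).
Proof. by move=> c0; apply: integral_boundZ => //; rewrite mulr_ge0. Qed.

Let jap54 k : (jap2 k ^+ 5)^-1 <= (jap2 k ^+ 4)^-1.
Proof.
have J1 := jap2_ge1 k; have J0 := jap2_gt0 k.
by rewrite lef_pV2 ?posrE ?exprn_gt0 // ler_weXn2l.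
Qed.

(** The divergence [W], of integral 0, contains the opposite of the damped integrand,
    from the derivative of the sine; their sum only keeps terms of size [K / Phi]. *)
Lemma cutoff_damped_le n :
  mu2.-integrable setT (EFin \o (fun k => cutoff n k * damped k)) ->
  `|Rintegral mu2 setT (fun k => cutoff n k * damped k)| <= 12 * N * E.
Proof.
move=> iZ.
have mc := @measurable_cutoff n.
have mH : measurable_fun setT H by have h := measurable_phase t; rewrite /H; measurability.
have mf : measurable_fun setT (fun k => cutoff n k * amp k) by rewrite /amp; measurability.
have [|k kn|k kn|W [iW W0 WE]] := @weak_radial_divergence R G G1 G2
  (fun k => cutoff n k * amp k) _ n.+1%:R^-1 n.+1 wG iG iG1 iG2 mf
  (radial_derivativeM (radial_cutoff n) radial_amp).
- by rewrite invr_gt0.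
- have [k0|k0] := eqVneq k.1 0; first by rewrite amp_axis // mulr0.
  by rewrite cutoff_near_axis // mul0r.
- by rewrite cutoff_off_box // mul0r.
pose Z k := cutoff n k * damped k.
have iWZ : mu2.-integrable setT (EFin \o (fun k => W k + Z k)).
  exact: (integrableD measurableT iW iZ).
have -> : Rintegral mu2 setT Z = Rintegral mu2 setT (fun k => W k + Z k).
  by rewrite RintegralD // W0 add0r.
have mWZ : measurable_fun setT (fun k => W k + Z k).
  by apply/measurable_EFinP; exact: measurable_int iWZ.
have [||_ //] := plane_Rintegral_le mWZ _ (@dominating_bound 12 _); last by [].
apply: ae_plane2 ae_offaxis (ae_plane2 (fun k h1 h2 => conj h1 h2) bG gradient_le) => k k0 [Gk gk].
have p0 := phase_neq0 t0 k0.
have -> : W k + Z k =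
  (cutoff' n k * (S k * (damping (r k) * H k)) +
   cutoff n k * (S k * (damping' (r k) * (2 * r k) * H k)) +
   2 * (cutoff n k * (S k * (damping (r k) * H k)))) * G k +
  cutoff n k * (S k * (damping (r k) * H k)) * (k.1 * G1 k + k.2 * G2 k).
  rewrite WE // /Z /damped /amp' /amp.
  have -> : K k = H k * phase t k by rewrite /H divfK.
  have -> : linear_phase z y k = r k * phase t k by rewrite /r /phase_ratio mulfVK.
  ring.
have Sk : `|S k| <= 1 by rewrite ler_norml sin_geN1 sin_le1.
have le12 := parts_integrand_le (H k) (norm_cutoff_le1 n k) (norm_cutoff'_le1 n k) Sk
  (norm_damping_le (r k)) (norm_damping'_le (r k)) Gk gk.
apply: (le_trans le12).
rewrite -mulrA; apply: ler_wpM2l => //; rewrite [leRHS]mulrCA; apply: ler_wpM2l => //.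
by apply: ler_wpM2l => //; exact: jap54.
Qed.

Lemma damped_integrable : mu2.-integrable setT (EFin \o damped) /\
  (forall n, mu2.-integrable setT (EFin \o (fun k => cutoff n k * damped k))).
Proof.
have md : measurable_fun setT damped by rewrite /damped; measurability.
have bd : integral_bound mu2 (fun k => 2 * N * (`|K k| * (jap2 k ^+ 5)^-1)) (2 * N * C).
  by apply: integral_boundZ => //; rewrite mulr_ge0.
have id : mu2.-integrable setT (EFin \o damped).
  have [|i _] := plane_Rintegral_le md _ bd; last exact: i.
  apply: ae_plane2 bG bG => k Gk _; rewrite /damped.
  have -> : 2 * N * (`|K k| * (jap2 k ^+ 5)^-1) =
    1 * `|K k| * 2 * (N * (jap2 k ^+ 5)^-1) by ring.
  apply: ler_normM => //; apply: ler_normM; first apply: ler_normM => //.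
    by rewrite ler_norml cos_geN1 cos_le1.
  set x := r k; have q0 : 0 < 1 + x ^+ 2 by rewrite ltr_pwDl // sqr_ge0.
  rewrite /damping mulrA ger0_norm; last by rewrite divr_ge0 // -?expr2 ?sqr_ge0 // ltW.
  by rewrite ler_pdivrMr //; have := sqr_ge0 (1 + x); nra.
split => // n; apply: (@integrable_bounded_mul R _ _ mu2 _ _ 1 _ _ id).
  exact: measurable_cutoff.
exact: norm_cutoff_le1.
Qed.

(** The bound with a cut-off does not depend on the cut-off. *)
Lemma damped_le : `|Rintegral mu2 setT damped| <= 12 * N * E.
Proof.
have [id icd] := damped_integrable.
have cvg_int : (\int[mu2]_k (cutoff n k * damped k)%:E @[n --> \oo] -->
    \int[mu2]_k (damped k)%:E)%E.
  have [|||||_ _ //] := @dominated_convergence _ _ _ mu2 setT measurableT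
    (fun n k => (cutoff n k * damped k)%:E) (fun k => (damped k)%:E)
    (fun k => `|(damped k)%:E|%E).
  - by move=> n; exact: measurable_int (icd n).
  - exact: measurable_int id.
  - apply: aeW => k _ /=; apply: cvg_EFin; first exact: nearW.
    rewrite /comp /= -[X in _ --> X]mul1r; apply: cvgM; first exact: cutoff_cvg.
    exact: cvg_cst.
  - exact: integrable_abse.
  - by apply: aeW => k n _ /=; rewrite lee_fin normrM ler_piMl // norm_cutoff_le1.
rewrite -lee_fin EFin_normr_Rintegral //.
have cvg_abs : (`|\int[mu2]_k (cutoff n k * damped k)%:E| @[n --> \oo] -->
    `|\int[mu2]_k (damped k)%:E|)%E by exact: cvg_abse.
rewrite -(cvg_lim _ cvg_abs) //; apply: lime_le; first exact: cvgP cvg_abs.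
apply: nearW => n; rewrite -EFin_normr_Rintegral //.
by rewrite lee_fin; exact: cutoff_damped_le.
Qed.

Let undamped k := T k * K k * (1 - (1 - r k) * damping (r k)) * G k.

(** The factor [2 r / (1 + r^2)] is at most [2 |L| / |Phi|], and [L] is at most
    [rho |k|]. *)
Lemma undamped_le : mu2.-integrable setT (EFin \o undamped) /\
  `|Rintegral mu2 setT undamped| <= 2 * Num.sqrt (z ^+ 2 + y ^+ 2) * N * E.
Proof.
have mu : measurable_fun setT undamped by rewrite /undamped; measurability.
set rho := Num.sqrt _; have rho0 : 0 <= rho by exact: sqrtr_ge0.
have b0 : 0 <= 2 * rho by rewrite mulr_ge0.
apply: plane_Rintegral_le mu _ (dominating_bound b0).
apply: ae_plane2 ae_offaxis bG => k k0 Gk.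
have p0 := phase_neq0 t0 k0; have J0 := jap2_gt0 k.
have q0 : 1 + r k ^+ 2 != 0 by rewrite gt_eqF // ltr_pwDl // sqr_ge0.
have -> : undamped k = T k * (H k * linear_phase z y k) * (2 / (1 + r k ^+ 2)) * G k.
  rewrite /undamped /damping /H.
  have -> : linear_phase z y k = r k * phase t k by rewrite /r /phase_ratio mulfVK.
  by field; apply/andP; split; first [exact: p0|exact: q0].
have -> : 2 * rho * N * (`|H k| * (jap2 k ^+ 4)^-1) =
    1 * (`|H k| * (rho * jap2 k)) * 2 * (N * (jap2 k ^+ 5)^-1).
  by field; rewrite gt_eqF.
apply: ler_normM => //; apply: ler_normM; first apply: ler_normM.
- by rewrite ler_norml cos_geN1 cos_le1.
- by apply: ler_normM => //; exact: norm_linear_phase_le.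
- have q1 : 1 <= 1 + r k ^+ 2 by rewrite lerDl sqr_ge0.
  rewrite ger0_norm; last by rewrite divr_ge0 // (le_trans ler01).
  by rewrite ler_pdivrMr ?(lt_le_trans ltr01) // ler_peMr.
Qed.

(** One power of [k] is lost on [L], hence the weight [jap2 ^ 4] in the hypothesis on
    [K / Phi], against [jap2 ^ 5] in the decay of [G]. *)
Lemma oscillatory_integral_le :
  mu2.-integrable setT (EFin \o (fun k => T k * K k * G k)) /\
  `|Rintegral mu2 setT (fun k => T k * K k * G k)| <=
    12 * (1 + Num.sqrt (z ^+ 2 + y ^+ 2)) * N * E.
Proof.
have [id _] := damped_integrable; have [iu ule] := undamped_le.
have e : (fun k => T k * K k * G k) = (fun k => damped k + undamped k).
  by apply/funext => k; rewrite /damped /undamped; ring.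
rewrite e; split; first exact: (integrableD measurableT id iu).
rewrite RintegralD //; apply: (le_trans (ler_normD _ _)).
have -> : 12 * (1 + Num.sqrt (z ^+ 2 + y ^+ 2)) * N * E =
  12 * N * E + 12 * (Num.sqrt (z ^+ 2 + y ^+ 2) * N * E) by ring.
apply: lerD; first exact: damped_le.
apply: (le_trans ule); rewrite -!mulrA; apply: ler_wpM2r; last by rewrite ler_nat.
have [_ h0 hE] := bH.
have E0 : 0 <= E.
  by rewrite -lee_fin; apply: le_trans hE; apply: integral_ge0 => k _; rewrite lee_fin.
by rewrite !mulr_ge0 // sqrtr_ge0.
Qed.

End Oscillatory.

(** * The kernels of the velocity components *)

Section Kernels.
Context {R : realType}.
Implicit Types (k : R * R) (t : R).

Definition shear_sqr t k : R := k.1 ^+ 2 + (k.2 - t * k.1) ^+ 2.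

Lemma shear_norm_sqr t k : shear_norm t k ^+ 2 = shear_sqr t k.
Proof. by rewrite sqr_sqrtr // addr_ge0 ?sqr_ge0. Qed.

Lemma shear_sqr_gt0 t k : k.1 != 0 -> 0 < shear_sqr t k.
Proof. by move=> k0; rewrite ltr_pwDl ?sqr_ge0 // exprn_even_gt0. Qed.

Lemma shear_norm_gt0 t k : k.1 != 0 -> 0 < shear_norm t k.
Proof. by move=> k0; rewrite sqrtr_gt0; exact: shear_sqr_gt0. Qed.

(** This is [atan_sum_ge] at the slope [k.2 / k.1], where the two square roots are
    [|k| / |k.1|] and [shear_norm / |k.1|]. *)
Lemma phase_inv_le t k : 0 < t -> k.1 != 0 ->
  `|(phase t k)^-1| <= jap2 k * shear_norm t k / (t * `|k.1|).
Proof.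
move=> t0 k0; have x0 : 0 < `|k.1| by rewrite normr_gt0.
have J0 := jap2_gt0 k; have M0 := shear_norm_gt0 t k0.
have k0' : k.1 != 0 := k0.
have sq (b : R) : Num.sqrt (1 + (b / k.1) ^+ 2) = Num.sqrt (k.1 ^+ 2 + b ^+ 2) / `|k.1|.
  rewrite -sqrtr_sqr -sqrtrV ?sqr_ge0 // -sqrtrM ?addr_ge0 ?sqr_ge0 //.
  by congr Num.sqrt; field; exact: k0'.
have h := atan_sum_ge (k.2 / k.1) t0.
have e : t - k.2 / k.1 = (t * k.1 - k.2) / k.1 by field; exact: k0'.
rewrite [in X in X <= _]e !sq in h.
have {h}h : t / ((jap2 k / `|k.1|) * (shear_norm t k / `|k.1|)) <=
    atan (t - k.2 / k.1) + atan (k.2 / k.1).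
  have P1 : 0 < (jap2 k / `|k.1|) * (shear_norm t k / `|k.1|) by rewrite !mulr_gt0 // invr_gt0.
  have P2 : 0 < Num.sqrt (k.1 ^+ 2 + k.2 ^+ 2) / `|k.1| *
      (Num.sqrt (k.1 ^+ 2 + (t * k.1 - k.2) ^+ 2) / `|k.1|).
    by rewrite !mulr_gt0 // ?invr_gt0 // sqrtr_gt0 ltr_pwDl ?sqr_ge0 // exprn_even_gt0.
  apply: le_trans h; rewrite ler_pM2l // lef_pV2 ?posrE //.
  have -> : (t * k.1 - k.2) ^+ 2 = (k.2 - t * k.1) ^+ 2 by ring.
  apply: ler_wpM2r; first by rewrite divr_ge0 // ltW.
  apply: ler_wpM2r; first by rewrite invr_ge0.
  by rewrite ler_sqrt; [rewrite -addrA lerDr|rewrite -addrA !addr_ge0 ?sqr_ge0].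
set A := _ + _ in h.
have B0 : 0 < t / ((jap2 k / `|k.1|) * (shear_norm t k / `|k.1|)).
  by rewrite divr_gt0 // !mulr_gt0 // invr_gt0.
have A0 : 0 < A by exact: lt_le_trans h.
rewrite /phase -/A invfM invrK normrM (gtr0_norm (x := A^-1)) ?invr_gt0 //.
apply: (@le_trans _ _ (`|k.1| * (t / ((jap2 k / `|k.1|) * (shear_norm t k / `|k.1|)))^-1)).
  by apply: ler_wpM2l => //; rewrite lef_pV2 ?posrE.
rewrite le_eqVlt; apply/orP; left; apply/eqP; field.
by rewrite ?gt_eqF //= ?gt_eqF.
Qed.

Lemma norm_sqr_le_shear_sqr t k : k.1 ^+ 2 + k.2 ^+ 2 <= (2 + 2 * t ^+ 2) * shear_sqr t k.
Proof.
rewrite /shear_sqr; set a := k.2 - t * k.1.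
have -> : k.2 = a + t * k.1 by rewrite /a; ring.
have := sqr_ge0 (a - t * k.1); have := sqr_ge0 (t * a); have := sqr_ge0 k.1; nra.
Qed.

Definition kernel_z t k : R := k.1 / shear_sqr t k.
Definition kernel_y t k : R := k.2 / shear_sqr t k.
(** Comparable with [k.2 ^ 2 + t ^ 2 * k.1 ^ 2]: it does not degenerate on the line
    [k.2 = t * k.1], where [shear_sqr] is small. *)
Definition shear_weight t k : R := shear_sqr t k + t ^+ 2 * k.1 ^+ 2.
Definition kernel_y_core t k : R :=
  k.2 * (t ^+ 2 * k.1 ^+ 2) / (shear_sqr t k * shear_weight t k).
Definition kernel_y_tail t k : R := k.2 / shear_weight t k.

(** The tail carries the region [|k.1| << |k.2| / t] in which the phase does not
    oscillate; the core vanishes on the axis to second order. Both are homogeneous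
    of degree -1. *)
Lemma kernel_y_split t k : kernel_y t k = kernel_y_core t k + kernel_y_tail t k.
Proof.
rewrite /kernel_y /kernel_y_core /kernel_y_tail.
have [k20|k20] := eqVneq k.2 0; first by rewrite k20 !mul0r addr0.
have s0 : 0 < shear_sqr t k.
  have [k10|k10] := eqVneq k.1 0; last exact: shear_sqr_gt0.
  by rewrite /shear_sqr k10 mulr0 subr0 expr0n add0r exprn_even_gt0.
have w0 : 0 < shear_weight t k by rewrite ltr_pwDl // mulr_ge0 // sqr_ge0.
have -> : t ^+ 2 * k.1 ^+ 2 = shear_weight t k - shear_sqr t k by rewrite /shear_weight; ring.
by field; rewrite !gt_eqF.
Qed.

Lemma radial_shear_sqr t :
  radial_derivative (shear_sqr t) (fun k => 2 * shear_sqr t k).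
Proof.
have h1 := @radial_derivative_fst R; have h2 := @radial_derivative_snd R.
have ha := radial_derivativeD h2 (radial_derivativeN (radial_derivativeM (radial_derivative_cst t) h1)).
have h := radial_derivativeD (radial_derivativeM h1 h1) (radial_derivativeM ha ha).
by apply: eq_radial_derivative h => k k0; rewrite /shear_sqr; ring.
Qed.

Lemma radial_shear_weight t :
  radial_derivative (shear_weight t) (fun k => 2 * shear_weight t k).
Proof.
have h1 := @radial_derivative_fst R.
have h := radial_derivativeD (radial_shear_sqr t)
  (radial_derivativeM (radial_derivative_cst (t ^+ 2)) (radial_derivativeM h1 h1)).
by apply: eq_radial_derivative h => k k0; rewrite /shear_weight; ring.
Qed.

Lemma shear_weight_gt0 t k : k.1 != 0 -> 0 < shear_weight t k.
Proof.
by move=> k0; rewrite ltr_pwDl ?shear_sqr_gt0 // mulr_ge0 // sqr_ge0.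
Qed.

Lemma radial_kernel_z t : radial_derivative (kernel_z t) (fun k => - kernel_z t k).
Proof.
have h := radial_derivativeM (@radial_derivative_fst R)
  (radial_derivativeV (radial_shear_sqr t) (fun k hk => lt0r_neq0 (shear_sqr_gt0 t hk))).
apply: eq_radial_derivative h => k k0; rewrite /kernel_z.
by field; exact: lt0r_neq0 (shear_sqr_gt0 t k0).
Qed.

Lemma radial_kernel_y_core t :
  radial_derivative (kernel_y_core t) (fun k => - kernel_y_core t k).
Proof.
have h1 := @radial_derivative_fst R; have h2 := @radial_derivative_snd R.
have hs := radial_derivativeV (radial_shear_sqr t) (fun k hk => lt0r_neq0 (shear_sqr_gt0 t hk)).
have hw := radial_derivativeV (radial_shear_weight t) (fun k hk => lt0r_neq0 (shear_weight_gt0 t hk)).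
have h := radial_derivativeM (radial_derivativeM h2 (radial_derivativeM
  (radial_derivative_cst (t ^+ 2)) (radial_derivativeM h1 h1))) (radial_derivativeM hs hw).
have e : kernel_y_core t = fun k => k.2 * (t ^+ 2 * (k.1 * k.1)) *
  ((shear_sqr t k)^-1 * (shear_weight t k)^-1).
  by apply/funext => k; rewrite /kernel_y_core invfM.
rewrite e; apply: eq_radial_derivative h => k k0.
have := lt0r_neq0 (shear_sqr_gt0 t k0); have := lt0r_neq0 (shear_weight_gt0 t k0).
set a := shear_sqr t k; set b := shear_weight t k => b0 a0.
by field; rewrite a0 b0.
Qed.

Lemma measurable_shear_sqr t : measurable_fun setT (shear_sqr t).
Proof. by rewrite /shear_sqr; measurability. Qed.

Lemma measurable_kernel_z t : measurable_fun setT (kernel_z t).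
Proof. by have h := measurable_shear_sqr t; rewrite /kernel_z; measurability. Qed.

Lemma measurable_kernel_y t : measurable_fun setT (kernel_y t).
Proof. by have h := measurable_shear_sqr t; rewrite /kernel_y; measurability. Qed.

Lemma measurable_kernel_y_core t : measurable_fun setT (kernel_y_core t).
Proof.
by have h := measurable_shear_sqr t; rewrite /kernel_y_core /shear_weight; measurability.
Qed.

Lemma measurable_kernel_y_tail t : measurable_fun setT (kernel_y_tail t).
Proof.
by have h := measurable_shear_sqr t; rewrite /kernel_y_tail /shear_weight; measurability.
Qed.

Lemma sqr_sum_le_shear_weight t k : k.2 ^+ 2 + t ^+ 2 * k.1 ^+ 2 <= 3 * shear_weight t k.
Proof.
rewrite /shear_weight /shear_sqr; set a := k.2 - t * k.1.
have -> : k.2 = a + t * k.1 by rewrite /a; ring.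
have := sqr_ge0 (a - t * k.1); have := sqr_ge0 k.1; have := sqr_ge0 a; have := sqr_ge0 (t * k.1); nra.
Qed.

(** The quotient is at most [|k| / (t M)]. *)
Lemma kernel_z_phase_le t k : 0 < t -> k.1 != 0 ->
  `|kernel_z t k / phase t k| * (jap2 k ^+ 4)^-1 <= t^-1 * (jap2 k ^+ 3 * shear_norm t k)^-1.
Proof.
move=> t0 k0; have x0 : 0 < `|k.1| by rewrite normr_gt0.
have J0 := jap2_gt0 k; have M0 := shear_norm_gt0 t k0.
have h := phase_inv_le t0 k0.
rewrite normrM /kernel_z -shear_norm_sqr normrM (gtr0_norm (x := _^-1)) ?invr_gt0 ?exprn_gt0 //.
apply: (@le_trans _ _ (`|k.1| / shear_norm t k ^+ 2 * (jap2 k * shear_norm t k / (t * `|k.1|)) *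
   (jap2 k ^+ 4)^-1)).
  apply: ler_wpM2r; first by rewrite invr_ge0 exprn_ge0 // ltW.
  by apply: ler_wpM2l => //; rewrite divr_ge0 // exprn_ge0 // ltW.
rewrite le_eqVlt; apply/orP; left; apply/eqP; field.
by rewrite ?gt_eqF //= ?gt_eqF.
Qed.

(** Here [t |k.1| |k.2|] is absorbed in [shear_weight], so no power of [t] is gained
    and none is lost. *)
Lemma kernel_y_core_phase_le t k : 0 < t -> k.1 != 0 ->
  `|kernel_y_core t k / phase t k| * (jap2 k ^+ 4)^-1 <= 2 * (jap2 k ^+ 3 * shear_norm t k)^-1.
Proof.
move=> t0 k0; have x0 : 0 < `|k.1| by rewrite normr_gt0.
have J0 := jap2_gt0 k; have M0 := shear_norm_gt0 t k0; have w0 := shear_weight_gt0 t k0.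
have h := phase_inv_le t0 k0.
rewrite normrM /kernel_y_core -shear_norm_sqr.
have -> : `|k.2 * (t ^+ 2 * k.1 ^+ 2) / (shear_norm t k ^+ 2 * shear_weight t k)| =
  `|k.2| * (t ^+ 2 * `|k.1| ^+ 2) / (shear_norm t k ^+ 2 * shear_weight t k).
  have hh : 0 <= t ^+ 2 * k.1 ^+ 2 by apply: mulr_ge0; exact: sqr_ge0.
  rewrite normrM (normrM k.2) (ger0_norm hh) (gtr0_norm (x := _^-1)) ?(real_normK (num_real k.1)) //.
  by rewrite invr_gt0 mulr_gt0 // exprn_gt0.
apply: (@le_trans _ _ (`|k.2| * (t ^+ 2 * `|k.1| ^+ 2) / (shear_norm t k ^+ 2 * shear_weight t k) *
   (jap2 k * shear_norm t k / (t * `|k.1|)) * (jap2 k ^+ 4)^-1)).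
  apply: ler_wpM2r; first by rewrite invr_ge0 exprn_ge0 // ltW.
  apply: ler_wpM2l => //; rewrite divr_ge0 ?mulr_ge0 ?sqr_ge0 //; exact: ltW.
have -> : `|k.2| * (t ^+ 2 * `|k.1| ^+ 2) / (shear_norm t k ^+ 2 * shear_weight t k) *
   (jap2 k * shear_norm t k / (t * `|k.1|)) * (jap2 k ^+ 4)^-1 =
  (`|k.2| * (t * `|k.1|) / shear_weight t k) * (jap2 k ^+ 3 * shear_norm t k)^-1.
  by field; rewrite ?gt_eqF //= ?gt_eqF.
apply: ler_wpM2r; first by rewrite invr_ge0 mulr_ge0 ?exprn_ge0 // ltW.
rewrite ler_pdivrMr //; have := sqr_sum_le_shear_weight t k.
rewrite -(real_normK (num_real k.1)) -(real_normK (num_real k.2)).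
have := sqr_ge0 (`|k.2| - t * `|k.1|); nra.
Qed.

Lemma kernel_y_tail_le t k : 0 < t -> k.1 != 0 ->
  `|kernel_y_tail t k| * (jap2 k ^+ 5)^-1 <=
  3 * (`|k.2| * (k.2 ^+ 2 + t ^+ 2 * k.1 ^+ 2)^-1 * (1 + k.2 ^+ 2)^-1).
Proof.
move=> t0 k0; have w0 := shear_weight_gt0 t k0; have J0 := jap2_gt0 k; have J1 := jap2_ge1 k.
have q0 : 0 < k.2 ^+ 2 + t ^+ 2 * k.1 ^+ 2.
  by rewrite ltr_wpDl ?sqr_ge0 // mulr_gt0 ?(exprn_gt0 2 t0) // exprn_even_gt0.
have y0 : 0 < 1 + k.2 ^+ 2 by rewrite ltr_pwDl // sqr_ge0.
rewrite /kernel_y_tail normrM (gtr0_norm (x := _^-1)) ?invr_gt0 //.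
set q := k.2 ^+ 2 + _ in q0 *; rewrite -[leLHS]mulrA.
have -> : 3 * (`|k.2| * q^-1 * (1 + k.2 ^+ 2)^-1) = `|k.2| * (3 * q^-1 * (1 + k.2 ^+ 2)^-1).
  by rewrite -mulrA mulrCA !mulrA.
apply: ler_wpM2l => //.
apply: ler_pM; [by rewrite invr_ge0 ltW|by rewrite invr_ge0 exprn_ge0 // ltW| |].
  rewrite -[leLHS]mul1r ler_pdivrMr // mulrAC ler_pdivlMr // mul1r.
  exact: sqr_sum_le_shear_weight.
rewrite lef_pV2 ?posrE ?exprn_gt0 //.
apply: (@le_trans _ _ (jap2 k ^+ 2)); last by rewrite ler_weXn2l.
by rewrite jap2_sqr lerD2r lerDl sqr_ge0.
Qed.

Lemma sqrt_mul_le (a b : R) : 0 <= a -> 0 <= b -> Num.sqrt a * Num.sqrt b <= (a + b) / 2.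
Proof.
move=> a0 b0; have := sqr_ge0 (Num.sqrt a - Num.sqrt b).
by rewrite sqrrB !sqr_sqrtr // => h; rewrite ler_pdivlMr //; lra.
Qed.

(** The integrable majorant behind every absolute convergence below. *)
Lemma jap2_weight_le k : k.1 != 0 -> k.2 != 0 ->
  (Num.sqrt `|k.1| * Num.sqrt `|k.2|)^-1 * (jap2 k ^+ 2)^-1 <=
  4 * (rsqrt_weight k.1 * rsqrt_weight k.2).
Proof.
move=> k1 k2; have x0 : 0 < `|k.1| by rewrite normr_gt0.
have y0 : 0 < `|k.2| by rewrite normr_gt0.
have sx0 : 0 < Num.sqrt `|k.1| by rewrite sqrtr_gt0.
have sy0 : 0 < Num.sqrt `|k.2| by rewrite sqrtr_gt0.
have J0 := jap2_gt0 k; have J1 := jap2_ge1 k.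
rewrite /rsqrt_weight.
have -> : 4 * ((Num.sqrt `|k.1| * (1 + `|k.1|))^-1 * (Num.sqrt `|k.2| * (1 + `|k.2|))^-1) =
  (Num.sqrt `|k.1| * Num.sqrt `|k.2|)^-1 * (4 * ((1 + `|k.1|) * (1 + `|k.2|))^-1).
  by field; rewrite ?gt_eqF //= ?gt_eqF //= ?addr_gt0.
apply: ler_wpM2l; first by rewrite invr_ge0 mulr_ge0 // ltW.
have p0 : 0 < (1 + `|k.1|) * (1 + `|k.2|) by rewrite mulr_gt0 // addr_gt0.
rewrite ler_pdivlMr // mulrC ler_pdivrMr ?exprn_gt0 //.
have -> : 4 * jap2 k ^+ 2 = (2 * jap2 k) * (2 * jap2 k) by ring.
have := norm_fst_jap2 k; have := norm_snd_jap2 k.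
by move=> ? ?; apply: ler_pM; lra.
Qed.

End Kernels.

(** * Decay of the real oscillatory integrals *)

Section Estimates.
Context {R : realType}.
Implicit Types (k : R * R) (t z y alpha N : R) (K G : R * R -> R).

Lemma ae_both_offaxis : {ae mu2, forall k, k.1 != 0 /\ k.2 != 0}.
Proof.
have h2 : {ae mu2, forall k : R * R, k.2 != 0}.
  exists (setT `*` [set 0]); split.
  - exact: measurableX.
  - rewrite /mu2 product_measure1E //.
    by rewrite [X in (_ * X)%E]lebesgue_measure_set1 mule0.
  - by move=> k /= /negP; rewrite negbK => /eqP.
exact: ae_plane2 (fun k h h' => conj h h') ae_offaxis h2.
Qed.

Variables (W A : R).
Hypothesis W0 : 0 <= W.
Hypothesis A0 : 0 <= A.
Hypothesis weight_bound :
  integral_bound mu2 (fun k => rsqrt_weight k.1 * rsqrt_weight k.2) W.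
Hypothesis shear_bound : forall t, 0 < t ->
  integral_bound mu2 (fun k => (jap2 k ^+ 3 * shear_norm t k)^-1) (A * (ln (t + 2) / t)).

Lemma weight2_bound c : 0 <= c ->
  integral_bound mu2 (fun k => c * (rsqrt_weight k.1 * rsqrt_weight k.2)) (c * W).
Proof. by move=> c0; exact: integral_boundZ. Qed.

Lemma jap2_bound : integral_bound mu2 (fun k => (jap2 k ^+ 5)^-1) (4 * W).
Proof.
apply: (@integral_bound_le _ _ _ mu2 _ _ _ _ _ _ (weight2_bound (ler0n R 4))) => //.
- by apply: (measurableT_comp measurable_inv); apply: measurable_funX; exact: measurable_jap2.
- by move=> k; rewrite invr_ge0 exprn_ge0 // ltW // jap2_gt0.
- apply: ae_plane2 ae_both_offaxis ae_offaxis => k [k1 k2] _.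
  have J0 := jap2_gt0 k; have J1 := jap2_ge1 k.
  apply: le_trans (jap2_weight_le k1 k2).
  have s0 : 0 < Num.sqrt `|k.1| * Num.sqrt `|k.2| by rewrite mulr_gt0 // sqrtr_gt0 normr_gt0.
  have sJ0 : 0 < Num.sqrt `|k.1| * Num.sqrt `|k.2| * jap2 k ^+ 2.
    by rewrite mulr_gt0 // exprn_gt0.
  rewrite -invfM lef_pV2 ?posrE ?(exprn_gt0 _ J0) //.
  apply: (@le_trans _ _ (jap2 k ^+ 3)); last by rewrite ler_weXn2l.
  rewrite (exprS _ 2); apply: ler_wpM2r; first by rewrite exprn_ge0 // ltW.
  apply: (le_trans (sqrt_mul_le (normr_ge0 _) (normr_ge0 _))).
  by have := norm_fst_jap2 k; have := norm_snd_jap2 k; lra.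
Qed.

(** The shear changes [|k|^2] by at most the factor [2 + 2 t^2], which is harmless for
    bounded times and for integrability. *)
Lemma kernel_bound t K : measurable_fun setT K ->
  (forall k, k.1 != 0 -> `|K k| <= (`|k.1| + `|k.2|) / shear_sqr t k) ->
  integral_bound mu2 (fun k => `|K k| * (jap2 k ^+ 5)^-1) ((2 + 2 * t ^+ 2) * 4 * W).
Proof.
move=> mK KM; have c0 : 0 <= (2 + 2 * t ^+ 2) * 4 by have := sqr_ge0 t; lra.
apply: (@integral_bound_le _ _ _ mu2 _ _ _ _ _ _ (weight2_bound c0)) => //.
- apply: measurable_funM; first by measurability.
  by apply: (measurableT_comp measurable_inv); apply: measurable_funX; exact: measurable_jap2.
- by move=> k; rewrite mulr_ge0 // invr_ge0 exprn_ge0 // ltW // jap2_gt0.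
- apply: ae_plane2 ae_both_offaxis ae_offaxis => k [k1 k2] _.
  have J0 := jap2_gt0 k; have J1 := jap2_ge1 k.
  have M0 := shear_sqr_gt0 t k1.
  have s0 : 0 < Num.sqrt `|k.1| * Num.sqrt `|k.2| by rewrite mulr_gt0 // sqrtr_gt0 normr_gt0.
  have T0 : 0 < 2 + 2 * t ^+ 2 by have := sqr_ge0 t; lra.
  rewrite -mulrA; apply: (@le_trans _ _ ((2 + 2 * t ^+ 2) *
    ((Num.sqrt `|k.1| * Num.sqrt `|k.2|)^-1 * (jap2 k ^+ 2)^-1))); last first.
    by apply: ler_wpM2l (jap2_weight_le k1 k2); exact: ltW.
  rewrite mulrA; apply: ler_pM => //.
  + by rewrite invr_ge0 exprn_ge0 // ltW.
  + apply: (le_trans (KM _ k1)); rewrite ler_pdivrMr // mulrAC ler_pdivlMr //.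
    apply: le_trans (norm_sqr_le_shear_sqr t k).
    rewrite -(real_normK (num_real k.1)) -(real_normK (num_real k.2)).
    have := sqrt_mul_le (normr_ge0 k.1) (normr_ge0 k.2).
    have := sqr_ge0 (`|k.1| - `|k.2|); have := normr_ge0 k.1; have := normr_ge0 k.2.
    move=> a b c d; apply: (@le_trans _ _ ((`|k.1| + `|k.2|) * ((`|k.1| + `|k.2|) / 2))).
      by apply: ler_wpM2l => //; lra.
    nra.
  + by rewrite lef_pV2 ?posrE ?exprn_gt0 // ler_weXn2l.
Qed.

(** What the norms of the theorem say about the real or the imaginary part of the
    data. *)
Definition controlled N G G1 G2 : Prop :=
  [/\ weak_gradient G G1 G2,
      [/\ measurable_fun setT G, measurable_fun setT G1 & measurable_fun setT G2],
      {ae mu2, forall k, `|G k| <= N * (jap2 k ^+ 5)^-1},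
      {ae mu2, forall k, `|G1 k| <= N * (jap2 k ^+ 6)^-1} &
      {ae mu2, forall k, `|G2 k| <= N * (jap2 k ^+ 6)^-1}].

(** The shift [alpha] covers sine and cosine at once. *)
Definition oscillation t z y alpha K G k : R :=
  cos (total_phase t z y alpha k) * K k * G k.

Section Controlled.
Variables (N : R) (G G1 G2 : R * R -> R).
Hypothesis N0 : 0 <= N.
Hypothesis cG : controlled N G G1 G2.

Let integrable_of_decay (f : R * R -> R) : measurable_fun setT f ->
  {ae mu2, forall k, `|f k| <= N * (jap2 k ^+ 5)^-1} -> mu2.-integrable setT (EFin \o f).
Proof.
move=> mf fN.
by have [] := plane_Rintegral_le mf fN (integral_boundZ N0 jap2_bound).
Qed.

Let decay56 (f : R * R -> R) : {ae mu2, forall k, `|f k| <= N * (jap2 k ^+ 6)^-1} ->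
  {ae mu2, forall k, `|f k| <= N * (jap2 k ^+ 5)^-1}.
Proof.
move=> h; apply: (ae_plane2 _ h h) => k fk _; apply: (le_trans fk); apply: ler_wpM2l => //.
by rewrite lef_pV2 ?posrE ?exprn_gt0 ?jap2_gt0 // ler_weXn2l // jap2_ge1.
Qed.

Lemma oscillation_trivial t z y alpha K C : measurable_fun setT K ->
  integral_bound mu2 (fun k => `|K k| * (jap2 k ^+ 5)^-1) C ->
  mu2.-integrable setT (EFin \o oscillation t z y alpha K G) /\
  `|Rintegral mu2 setT (oscillation t z y alpha K G)| <= N * C.
Proof.
move=> mK bK; have [_ [mG _ _] bG _ _] := cG.
have mo : measurable_fun setT (oscillation t z y alpha K G).
  by have h := measurable_total_phase t z y alpha; rewrite /oscillation; measurability.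
apply: plane_Rintegral_le mo _ (integral_boundZ N0 bK).
apply: (ae_plane2 _ bG bG) => k Gk _.
have -> : N * (`|K k| * (jap2 k ^+ 5)^-1) = 1 * `|K k| * (N * (jap2 k ^+ 5)^-1) by ring.
apply: ler_normM => //; apply: ler_normM => //.
by rewrite ler_norml cos_geN1 cos_le1.
Qed.

Lemma oscillation_decay t z y alpha K C E : 0 < t ->
  measurable_fun setT K -> radial_derivative K (fun k => - K k) ->
  integral_bound mu2 (fun k => `|K k| * (jap2 k ^+ 5)^-1) C ->
  integral_bound mu2 (fun k => `|K k / phase t k| * (jap2 k ^+ 4)^-1) E ->
  `|Rintegral mu2 setT (oscillation t z y alpha K G)| <=
    12 * (1 + Num.sqrt (z ^+ 2 + y ^+ 2)) * N * E.
Proof.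
move=> t0 mK rK bK bH; have [wG [mG mG1 mG2] bG bG1 bG2] := cG.
have iG := integrable_of_decay mG bG.
have iG1 := integrable_of_decay mG1 (decay56 bG1).
have iG2 := integrable_of_decay mG2 (decay56 bG2).
by have [] := oscillatory_integral_le z y alpha t0 N0 mK rK bH bK wG iG iG1 iG2 bG bG1 bG2.
Qed.

Lemma kernel_phase_bound t K c : 0 < t -> 0 <= c -> measurable_fun setT K ->
  (forall k, k.1 != 0 -> `|K k / phase t k| * (jap2 k ^+ 4)^-1 <=
     c * (jap2 k ^+ 3 * shear_norm t k)^-1) ->
  integral_bound mu2 (fun k => `|K k / phase t k| * (jap2 k ^+ 4)^-1)
    (c * (A * (ln (t + 2) / t))).
Proof.
move=> t0 c0 mK h.
apply: (@integral_bound_le _ _ _ mu2 _ _ _ _ _ _ (integral_boundZ c0 (shear_bound t0))).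
- have mp := measurable_phase t; have mJ := @measurable_jap2 R.
  by measurability.
- by move=> k; rewrite mulr_ge0 // invr_ge0 exprn_ge0 // ltW // jap2_gt0.
- by apply: ae_plane2 ae_offaxis ae_offaxis => k k0 _; exact: h.
Qed.

Lemma norm_kernel_z_le t k : k.1 != 0 ->
  `|kernel_z t k| <= (`|k.1| + `|k.2|) / shear_sqr t k.
Proof.
move=> k0; have M0 := shear_sqr_gt0 t k0.
rewrite /kernel_z normrM (gtr0_norm (x := _^-1)) ?invr_gt0 //.
by apply: ler_wpM2r; [rewrite invr_ge0 ltW|rewrite lerDl].
Qed.

Lemma norm_kernel_y_core_le t k : k.1 != 0 ->
  `|kernel_y_core t k| <= (`|k.1| + `|k.2|) / shear_sqr t k.
Proof.
move=> k0; have M0 := shear_sqr_gt0 t k0; have w0 := shear_weight_gt0 t k0.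
have -> : kernel_y_core t k = (k.2 * (t ^+ 2 * k.1 ^+ 2 / shear_weight t k)) / shear_sqr t k.
  by rewrite /kernel_y_core; field; rewrite !gt_eqF.
have h0 : 0 <= t ^+ 2 * k.1 ^+ 2 by apply: mulr_ge0; exact: sqr_ge0.
have q1 : `|t ^+ 2 * k.1 ^+ 2 / shear_weight t k| <= 1.
  rewrite ger0_norm; last by rewrite divr_ge0 // ltW.
  by rewrite ler_pdivrMr // mul1r lerDr ltW.
rewrite normrM (gtr0_norm (x := (shear_sqr t k)^-1)) ?invr_gt0 //.
apply: ler_wpM2r; first by rewrite invr_ge0 ltW.
rewrite normrM; apply: (@le_trans _ _ (`|k.2| * 1)); first exact: ler_wpM2l.
by rewrite mulr1 lerDr.
Qed.

Lemma jap_ge1 t : 1 <= jap t.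
Proof. by rewrite -[leLHS]sqrtr1 ler_sqrt ?lerDl ?addr_ge0 ?sqr_ge0. Qed.

Lemma jap_sqr t : jap t ^+ 2 = 1 + t ^+ 2.
Proof. by rewrite sqr_sqrtr // addr_ge0 ?sqr_ge0. Qed.

Lemma jap_powR_le t : jap t `^ (3 / 2) <= 1 + t ^+ 2.
Proof.
rewrite -jap_sqr -powR_mulrn; last by rewrite sqrtr_ge0.
by apply: ler_powR; [exact: jap_ge1|lra].
Qed.

Lemma jap_powR_gt0 t : 0 < jap t `^ (3 / 2).
Proof. by rewrite powR_gt0 // (lt_le_trans ltr01) // jap_ge1. Qed.

(** For bounded times the decay rates are bounded below. *)
Lemma small_time_decay t (p : R) : 0 < t < 1 -> 0 < p -> p <= 1 + t ^+ 2 ->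
  1 <= 4 * (ln (t + 2) / p).
Proof.
move=> /andP[t0 t1] p0 pt; have L0 := ln_ge_half (ltW t0).
rewrite mulrA ler_pdivlMr // mul1r; apply: (le_trans pt); nra.
Qed.

(** Here [W] and [A] are the masses of the weight and of the shear integral: [64 W]
    serves the times below 1, [48 A] the oscillating kernels and 768 the Poisson
    tail. *)
Definition decay_constant : R := 64 * W + 48 * A + 768.

Lemma oscillation_small_time t z y alpha K (p : R) : 0 < t < 1 -> 0 < p -> p <= 1 + t ^+ 2 ->
  measurable_fun setT K ->
  (forall k, k.1 != 0 -> `|K k| <= (`|k.1| + `|k.2|) / shear_sqr t k) ->
  `|Rintegral mu2 setT (oscillation t z y alpha K G)| <=
    decay_constant * (1 + Num.sqrt (z ^+ 2 + y ^+ 2)) * N * (ln (t + 2) / p).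
Proof.
move=> t01 p0 pt mK KM; have d1 := small_time_decay t01 p0 pt.
have /andP[t0 t1] := t01.
have [_ triv] := oscillation_trivial t z y alpha mK (kernel_bound mK KM).
set rho := Num.sqrt _; have rho0 : 0 <= rho by exact: sqrtr_ge0.
have rN : N <= (1 + rho) * N by rewrite ler_peMl // lerDl.
have rN0 : 0 <= (1 + rho) * N by rewrite mulr_ge0 // addr_ge0.
set dec := ln (t + 2) / p in d1 *.
have dec0 : 0 <= dec by lra.
have -> : decay_constant * (1 + rho) * N * dec = (1 + rho) * N * (decay_constant * dec) by ring.
have t2 : t ^+ 2 <= 1 by rewrite expr_le1 // ltW.
apply: (le_trans triv); apply: ler_pM => //.
  by rewrite mulr_ge0 // mulr_ge0 // addr_ge0 // mulr_ge0 // sqr_ge0.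
apply: (@le_trans _ _ (16 * W * (4 * dec))).
  rewrite -[leLHS]mulr1; apply: ler_pM => //.
    by rewrite mulr_ge0 // mulr_ge0 // addr_ge0 // mulr_ge0 // sqr_ge0.
  by apply: ler_wpM2r => //; lra.
have : 0 <= A * dec by rewrite mulr_ge0.
by rewrite /decay_constant; lra.
Qed.

(** The kernel gives [1 / t] and the shear integral [ln (t + 2) / t]; the rate
    [1 / t^2] is stronger than the power [3 / 2]. *)
Lemma phi_z_oscillation_le t z y alpha : 0 < t ->
  mu2.-integrable setT (EFin \o oscillation t z y alpha (kernel_z t) G) /\
  `|Rintegral mu2 setT (oscillation t z y alpha (kernel_z t) G)| <=
    decay_constant * (1 + Num.sqrt (z ^+ 2 + y ^+ 2)) * N * (ln (t + 2) / jap t `^ (3 / 2)).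
Proof.
move=> t0; have mK := measurable_kernel_z t.
have bK := kernel_bound mK (@norm_kernel_z_le t).
split; first by have [] := oscillation_trivial t z y alpha mK bK.
have L0 := ln_ge_half (ltW t0); have p0 := jap_powR_gt0 t.
have [t1|t1] := ltP t 1.
  apply: oscillation_small_time => //; [by rewrite t0|exact: jap_powR_le|].
  exact: norm_kernel_z_le.
set rho := Num.sqrt _; have rho0 : 0 <= rho by exact: sqrtr_ge0.
have rN0 : 0 <= (1 + rho) * N by rewrite mulr_ge0 // addr_ge0.
set dec := ln (t + 2) / _.
have dec0 : 0 <= dec by rewrite divr_ge0 ?powR_ge0 //; lra.
have tV0 : 0 < t^-1 by rewrite invr_gt0.
have bH := kernel_phase_bound t0 (ltW tV0) mK (fun k hk => kernel_z_phase_le t0 hk).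
apply: (le_trans (oscillation_decay z y alpha t0 mK (radial_kernel_z t) bK bH)).
have h : t^-1 * (A * (ln (t + 2) / t)) <= A * (2 * dec).
  rewrite mulrCA; apply: ler_wpM2l => //.
  have -> : t^-1 * (ln (t + 2) / t) = ln (t + 2) * (t ^+ 2)^-1 by field; rewrite gt_eqF.
  rewrite /dec mulrCA; apply: ler_wpM2l; first lra.
  rewrite -[leLHS]mul1r ler_pdivrMr ?exprn_gt0 // mulrAC ler_pdivlMr // mul1r.
  by apply: (le_trans (jap_powR_le t)); nra.
apply: (@le_trans _ _ (12 * (1 + rho) * N * (A * (2 * dec)))).
  by apply: ler_wpM2l => //; rewrite -mulrA mulr_ge0.
have D0 : 0 <= (1 + rho) * N * dec by rewrite mulr_ge0.
have DA : 0 <= (1 + rho) * N * dec * A by rewrite mulr_ge0.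
have DW : 0 <= (1 + rho) * N * dec * W by rewrite mulr_ge0.
rewrite /decay_constant; lra.
Qed.

Lemma norm_kernel_y_le t k : k.1 != 0 ->
  `|kernel_y t k| <= (`|k.1| + `|k.2|) / shear_sqr t k.
Proof.
move=> k0; have M0 := shear_sqr_gt0 t k0.
rewrite /kernel_y normrM (gtr0_norm (x := _^-1)) ?invr_gt0 //.
by apply: ler_wpM2r; [rewrite invr_ge0 ltW|rewrite lerDr].
Qed.

(** The core decays like the shear integral and the tail like [1 / t]. *)
Lemma phi_y_oscillation_le t z y alpha : 0 < t ->
  mu2.-integrable setT (EFin \o oscillation t z y alpha (kernel_y t) G) /\
  `|Rintegral mu2 setT (oscillation t z y alpha (kernel_y t) G)| <=
    decay_constant * (1 + Num.sqrt (z ^+ 2 + y ^+ 2)) * N * (ln (t + 2) / jap t).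
Proof.
move=> t0; have mK := measurable_kernel_y_core t; have mT := measurable_kernel_y_tail t.
have mY := measurable_kernel_y t.
have bY := kernel_bound mY (@norm_kernel_y_le t).
split; first by have [] := oscillation_trivial t z y alpha mY bY.
have L0 := ln_ge_half (ltW t0).
have p0 : 0 < jap t by exact: lt_le_trans ltr01 (jap_ge1 t).
have [t1|t1] := ltP t 1.
  apply: oscillation_small_time => //; [by rewrite t0| |exact: norm_kernel_y_le].
  by rewrite -jap_sqr expr2 ler_peMl ?jap_ge1 // ltW.
have bK := kernel_bound mK (@norm_kernel_y_core_le t).
have [io _] := oscillation_trivial t z y alpha mK bK.
have bT : integral_bound mu2 (fun k => `|kernel_y_tail t k| * (jap2 k ^+ 5)^-1) (3 * (64 / t)).
  apply: (@integral_bound_le _ _ _ mu2 _ _ _ _ _ _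
    (integral_boundZ (ler0n R 3) (poisson_integral_bound t0))) => //.
  - apply: measurable_funM; first by measurability.
    by apply: (measurableT_comp measurable_inv); apply: measurable_funX; exact: measurable_jap2.
  - by move=> k; rewrite mulr_ge0 // invr_ge0 exprn_ge0 // ltW // jap2_gt0.
  - by apply: ae_plane2 ae_offaxis ae_offaxis => k k0 _; exact: kernel_y_tail_le.
have [iT tail] := oscillation_trivial t z y alpha mT bT.
have e : oscillation t z y alpha (kernel_y t) G =
    (fun k => oscillation t z y alpha (kernel_y_core t) G k +
              oscillation t z y alpha (kernel_y_tail t) G k).
  by apply/funext => k; rewrite /oscillation kernel_y_split; ring.
rewrite e RintegralD //; apply: (le_trans (ler_normD _ _)).
have bH := kernel_phase_bound t0 (ler0n R 2) mK (fun k hk => kernel_y_core_phase_le t0 hk).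
have core := oscillation_decay z y alpha t0 mK (radial_kernel_y_core t) bK bH.
move: core tail; set rho := Num.sqrt _ => core tail.
have rho0 : 0 <= rho by exact: sqrtr_ge0.
have rN : N <= (1 + rho) * N by rewrite ler_peMl // lerDl.
have rN0 : 0 <= (1 + rho) * N by rewrite mulr_ge0 // addr_ge0.
set dec := ln (t + 2) / jap t.
have dec0 : 0 <= dec by rewrite divr_ge0 //; [lra|exact: ltW].
have D0 : 0 <= (1 + rho) * N * dec by rewrite mulr_ge0.
have japt : jap t <= 2 * t.
  rewrite -[leRHS]ger0_norm; last lra.
  by rewrite -sqrtr_sqr ler_sqrt; nra.
have tV : t^-1 <= 2 * (jap t)^-1.
  by rewrite -[leLHS]mul1r ler_pdivrMr // mulrAC ler_pdivlMr // mul1r.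
have Lt : ln (t + 2) / t <= 2 * dec.
  by rewrite /dec mulrCA; apply: ler_wpM2l => //; lra.
have t4 : t^-1 <= 4 * dec.
  apply: (le_trans tV); rewrite /dec mulrA; apply: ler_wpM2r; last lra.
  by rewrite invr_ge0 ltW.
have c1 : 12 * (1 + rho) * N * (2 * (A * (ln (t + 2) / t))) <=
    12 * (1 + rho) * N * (2 * (A * (2 * dec))).
  apply: ler_wpM2l; first by rewrite -mulrA mulr_ge0.
  by do 2 apply: ler_wpM2l => //.
have DA : 0 <= (1 + rho) * N * dec * A by rewrite mulr_ge0.
have DW : 0 <= (1 + rho) * N * dec * W by rewrite mulr_ge0.
have c2 : N * (3 * (64 / t)) <= (1 + rho) * N * (3 * (64 * (4 * dec))).
  by apply: ler_pM => //; [rewrite !mulr_ge0 // invr_ge0 ltW|do 2 apply: ler_wpM2l => //].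
rewrite /decay_constant; lra.
Qed.

End Controlled.
End Estimates.

(** * From complex data to real oscillatory integrals *)

Local Open Scope complex_scope.

Section ComplexData.
Context {R : realType}.
Implicit Types (k : R * R) (t z y : R) (g : R * R -> R[i]).
Local Notation Re := (@complex.Re R).
Local Notation Im := (@complex.Im R).

Lemma norm_Re_le (c : R[i]) : `|Re c| <= cmod c.
Proof.
case: c => a b; rewrite /cmod /= -sqrtr_sqr ler_sqrt ?addr_ge0 ?sqr_ge0 //.
by rewrite lerDl sqr_ge0.
Qed.

Lemma norm_Im_le (c : R[i]) : `|Im c| <= cmod c.
Proof.
case: c => a b; rewrite /cmod /= -sqrtr_sqr ler_sqrt ?addr_ge0 ?sqr_ge0 //.
by rewrite lerDr sqr_ge0.
Qed.

Lemma cmod_le (c : R[i]) : cmod c <= `|Re c| + `|Im c|.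
Proof.
case: c => a b; rewrite /cmod /= -[leRHS]ger0_norm ?addr_ge0 //.
rewrite -sqrtr_sqr ler_sqrt ?sqr_ge0 // -(real_normK (num_real a)) -(real_normK (num_real b)).
by have := normr_ge0 a; have := normr_ge0 b; nra.
Qed.

Lemma cmod_scale_le (a : R) (c : R[i]) : 0 <= a <= 1 -> cmod (a%:C * c) <= cmod c.
Proof.
move=> /andP[a0 a1]; case: c => x y; rewrite /cmod /= !mul0r subr0 addr0.
rewrite ler_sqrt ?addr_ge0 ?sqr_ge0 // !exprMn -mulrDr ler_piMl ?addr_ge0 ?sqr_ge0 //.
by rewrite expr_le1.
Qed.

(** Real and imaginary parts each consist of two real integrals, those of the sine
    being shifts of the cosine by [pi / 2]. *)
Lemma cmod_oscillation_le t z y (K : R * R -> R) g (B : R) :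
  (forall alpha, mu2.-integrable setT (EFin \o oscillation t z y alpha K (fun k => Re (g k))) /\
     `|Rintegral mu2 setT (oscillation t z y alpha K (fun k => Re (g k)))| <= B) ->
  (forall alpha, mu2.-integrable setT (EFin \o oscillation t z y alpha K (fun k => Im (g k))) /\
     `|Rintegral mu2 setT (oscillation t z y alpha K (fun k => Im (g k)))| <= B) ->
  cmod ((((2 * pi) ^+ 3)^-1)%:C * cintegral (fun k =>
    expi (k.1 * z + k.2 * y + phase t k) * (0 +i* K k) * g k)) <= 4 * B.
Proof.
move=> hr hi.
have pi1 : 0 <= ((2 * pi : R) ^+ 3)^-1 <= 1.
  have p1 : 1 <= (2 * pi : R) ^+ 3.
    by rewrite exprn_ege1 //; have := @pi_ge2 R; lra.
  by rewrite invr_ge0 (le_trans ler01 p1) invf_le1 ?(lt_le_trans ltr01 p1).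
apply: (le_trans (cmod_scale_le _ pi1)); apply: (le_trans (cmod_le _)).
have [ir0 r0] := hr 0; have [irp rp] := hr (- (pi / 2)).
have [ii0 i0] := hi 0; have [iip ip] := hi (- (pi / 2)).
pose o a G := oscillation t z y a K G.
have -> : Re (cintegral (fun k => expi (k.1 * z + k.2 * y + phase t k) * (0 +i* K k) * g k)) =
  - (Rintegral mu2 setT (o (- (pi / 2)) (fun k => Re (g k))) +
     Rintegral mu2 setT (o 0 (fun k => Im (g k)))).
  rewrite -RintegralD // -mulN1r -RintegralZl //; last exact: (integrableD measurableT irp ii0).
  rewrite /cintegral /=; congr Rintegral; apply/funext => k.
  rewrite /o /oscillation /total_phase /linear_phase addr0 cosBpihalf.
  by case: (g k) => a b /=; ring.
have -> : Im (cintegral (fun k => expi (k.1 * z + k.2 * y + phase t k) * (0 +i* K k) * g k)) =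
  Rintegral mu2 setT (o 0 (fun k => Re (g k))) -
  Rintegral mu2 setT (o (- (pi / 2)) (fun k => Im (g k))).
  rewrite -RintegralB //.
  rewrite /cintegral /=; congr Rintegral; apply/funext => k.
  rewrite /o /oscillation /total_phase /linear_phase addr0 cosBpihalf.
  by case: (g k) => a b /=; ring.
rewrite normrN; have := ler_normD (Rintegral mu2 setT (o (- (pi / 2)) (fun k => Re (g k))))
  (Rintegral mu2 setT (o 0 (fun k => Im (g k)))).
have := ler_normB (Rintegral mu2 setT (o 0 (fun k => Re (g k))))
  (Rintegral mu2 setT (o (- (pi / 2)) (fun k => Im (g k)))).
rewrite /o; lra.
Qed.

Lemma measurable_box n : measurable (box n : set (R * R)).
Proof.
rewrite (_ : box n = `[- n%:R, n%:R] `*` `[- n%:R, n%:R]); first exact: measurableX.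
by apply/seteqP; split=> k; rewrite /box /= !in_itv /= !ler_norml.
Qed.

Lemma measurable_of_boxes (f : R * R -> R) :
  (forall n, mu2.-integrable (box n) (EFin \o f)) -> measurable_fun setT f.
Proof.
move=> fi; have -> : setT = \bigcup_n (box n : set (R * R)).
  apply/seteqP; split => // k _.
  pose m := maxn (Num.bound `|k.1|) (Num.bound `|k.2|).
  exists m => //; split; apply: (le_trans (ltW (archi_boundP (normr_ge0 _))));
    by rewrite ler_nat ?leq_maxl ?leq_maxr.
apply/measurable_fun_bigcup; first exact: measurable_box.
by move=> n; apply/measurable_EFinP; exact: measurable_int (fi n).
Qed.

(** The norm is an essential supremum only on a space of positive measure. *)
Lemma Linfty_ae_le (h : R * R -> R) : (Linfty h < +oo)%E ->
  {ae mu2, forall k, `|h k| <= fine (Linfty h)}.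
Proof.
move=> hoo; have h0 : (0 <= Linfty h)%E by exact: Lnorm_ge0.
have hE : (fine (Linfty h))%:E = Linfty h by rewrite fineK // ge0_fin_numE.
have muT : (0 < @mu2 R setT)%E.
  have lT : (0 < @lebesgue_measure R setT)%E.
    rewrite -set_itvNyy lebesgue_measure_itv /=; exact: lt0y.
  by rewrite -setXTT /mu2 product_measure1E //; apply: mule_gt0.
have le : \forall k \ae @mu2 R, (`|(h k)%:E| <= Linfty h)%E.
  by rewrite /Linfty unlock muT; exact: ess_sup_ge.
by apply: (ae_plane2 _ le le) => k + _; rewrite -hE lee_fin.
Qed.

Lemma jap2_cmod_ae_le n (u : R * R -> R) (f : R * R -> R) (N : R) :
  (Linfty (fun k => (jap2 k ^+ n * u k)%R) < +oo)%E ->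
  fine (Linfty (fun k => jap2 k ^+ n * u k)) <= N -> (forall k, `|f k| <= u k) ->
  {ae mu2, forall k, `|f k| <= N * (jap2 k ^+ n)^-1}.
Proof.
move=> /Linfty_ae_le h hN fu; apply: (ae_plane2 _ h h) => k uk _.
have J0 : 0 < jap2 k ^+ n by rewrite exprn_gt0 // jap2_gt0.
rewrite ler_pdivlMr // mulrC; apply: le_trans hN; apply: le_trans uk.
by rewrite normrM (gtr0_norm J0) ler_pM2l // (le_trans (fu k)) // ler_norm.
Qed.

Lemma weak_gradient_part (part : R[i] -> R) g g1 g2 :
  (part = Re \/ part = Im) -> is_weak_gradient g g1 g2 ->
  weak_gradient (part \o g) (part \o g1) (part \o g2).
Proof.
move=> partE [[_ _ h1] [_ _ h2]] psi tpsi.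
have scaleE (a : R) (w : R[i]) : part (a%:C * w) = a * part w.
  by case: partE => ->; case: w => x y /=; rewrite mul0r ?subr0 ?addr0.
have intE (a : R * R -> R) (w : R * R -> R[i]) :
    part (cintegral (fun k => (a k)%:C * w k)) = Rintegral mu2 setT (fun k => a k * part (w k)).
  transitivity (Rintegral mu2 setT (fun k => part ((a k)%:C * w k))).
    by case: partE => ->.
  by congr Rintegral; apply/funext => k; exact: scaleE.
have oppE (w : R[i]) : part (- w) = - part w by case: partE => ->; case: w.
split; [have := h1 psi tpsi|have := h2 psi tpsi] => /(congr1 part);
  by rewrite oppE !intE.
Qed.

Lemma controlled_part (part : R[i] -> R) g g1 g2 :
  (part = Re \/ part = Im) -> is_weak_gradient g g1 g2 ->
  (data_norm g g1 g2 < +oo)%E ->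
  0 <= fine (data_norm g g1 g2) /\
  controlled (fine (data_norm g g1 g2)) (part \o g) (part \o g1) (part \o g2).
Proof.
move=> partE wg; rewrite /data_norm.
set u0 := fun k => jap2 k ^+ 5 * cmod (g k).
set u1 := fun k => jap2 k ^+ 6 * Num.sqrt (cmod (g1 k) ^+ 2 + cmod (g2 k) ^+ 2).
have L0 : (0 <= Linfty u0)%E by exact: Lnorm_ge0.
have L1 : (0 <= Linfty u1)%E by exact: Lnorm_ge0.
move=> fin.
have f0 : (Linfty u0 < +oo)%E by apply: le_lt_trans fin; rewrite leeDl.
have f1 : (Linfty u1 < +oo)%E by apply: le_lt_trans fin; rewrite leeDr.
have fD : fine (Linfty u0 + Linfty u1) = fine (Linfty u0) + fine (Linfty u1).
  by rewrite fineD // ge0_fin_numE.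
have F0 : 0 <= fine (Linfty u0) by rewrite fine_ge0.
have F1 : 0 <= fine (Linfty u1) by rewrite fine_ge0.
have partle (w : R[i]) : `|part w| <= cmod w.
  by case: partE => ->; [exact: norm_Re_le|exact: norm_Im_le].
have meas (w : R * R -> R[i]) : locally_cintegrable w -> measurable_fun setT (part \o w).
  move=> lw; apply: measurable_of_boxes => n; have [? ?] := lw n.
  by case: partE => ->.
have [[lg lg1 _] [_ lg2 _]] := wg.
rewrite fD; split; first exact: addr_ge0.
split.
- exact: weak_gradient_part.
- by split; exact: meas.
- apply: (jap2_cmod_ae_le f0); first by rewrite lerDl.
  by move=> k; exact: partle.
- apply: (jap2_cmod_ae_le f1); first by rewrite lerDr.
  move=> k; apply: (le_trans (partle _)); rewrite -[leLHS]ger0_norm ?sqrtr_ge0 //.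
    by rewrite -sqrtr_sqr ler_sqrt ?addr_ge0 ?sqr_ge0 // lerDl sqr_ge0.
  by case: (g1 k) => x y; rewrite sqrtr_ge0.
- apply: (jap2_cmod_ae_le f1); first by rewrite lerDr.
  move=> k; apply: (le_trans (partle _)); rewrite -[leLHS]ger0_norm ?sqrtr_ge0 //.
    by rewrite -sqrtr_sqr ler_sqrt ?addr_ge0 ?sqr_ge0 // lerDr sqr_ge0.
  by case: (g2 k) => x y; rewrite sqrtr_ge0.
Qed.

(** The logarithm is bounded below, as one of [rho] and [1 / rho] is at least 1. *)
Lemma rho_factor_le (rho : R) : 0 < rho ->
  1 + rho <= 4 * (jap rho * ln (rho + rho^-1 + 1)).
Proof.
move=> r0; have rV : 0 < rho^-1 by rewrite invr_gt0.
have l2 : 2^-1 <= ln (rho + rho^-1 + 1).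
  apply: (le_trans (ln_ge_half (lexx 0))); rewrite add0r ler_ln ?posrE //; last lra.
  have [r1|r1] := leP 1 rho; first lra.
  have : 1 <= rho^-1 by rewrite invf_ge1 // ltW.
  lra.
have j1 : 1 + rho <= 2 * jap rho.
  have := jap_ge1 rho; have : rho <= jap rho.
    rewrite -[leLHS]gtr0_norm // -sqrtr_sqr ler_sqrt ?addr_ge0 ?sqr_ge0 //.
    by rewrite lerDr.
  lra.
have J0 : 0 < jap rho by exact: lt_le_trans ltr01 (jap_ge1 _).
nra.
Qed.

End ComplexData.
Local Close Scope complex_scope.
Local Close Scope classical_set_scope.

Theorem theorem1p1 (R : realType) :
  exists C : R, 0 < C /\
  forall (omega0 hat_omega0 d_xi d_eta : R * R -> complex R),
    is_fourier_transform omega0 hat_omega0 ->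
    is_weak_gradient hat_omega0 d_xi d_eta ->
    (data_norm hat_omega0 d_xi d_eta < +oo)%E ->
    forall t z y : R, 0 < t -> (z, y) <> (0, 0) ->
    let rho := Num.sqrt (z ^+ 2 + y ^+ 2) in
    cmod (phi_z hat_omega0 t z y)
      <= C * fine (data_norm hat_omega0 d_xi d_eta) * jap rho *
         ln (rho + rho^-1 + 1) * (ln (t + 2) / jap t `^ (3 / 2)) /\
    cmod (phi_y hat_omega0 t z y)
      <= C * fine (data_norm hat_omega0 d_xi d_eta) * jap rho *
         ln (rho + rho^-1 + 1) * (ln (t + 2) / jap t).
Proof.
(* The masses are kept abstract: only their existence matters from here on. *)
have [W [W0 weightW]] : exists W : R, 0 <= W /\
    integral_bound mu2 (fun k => rsqrt_weight k.1 * rsqrt_weight k.2) W.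
  by exists 256; split; [exact: ler0n|exact: rsqrt_weight2_bound].
have [A [A0 shearA]] : exists A : R, 0 <= A /\ forall t, 0 < t ->
    integral_bound mu2 (fun k => (jap2 k ^+ 3 * shear_norm t k)^-1) (A * (ln (t + 2) / t)).
  by exists 1664; split; [exact: ler0n|exact: shear_integral_bound].
have K0 : 0 < decay_constant W A.
  have : 0 <= 64 * W + 48 * A by rewrite addr_ge0 // mulr_ge0.
  by rewrite /decay_constant; lra.
exists (16 * decay_constant W A); split; first by rewrite mulr_gt0.
move=> omega0 g g1 g2 _ wg fin t z y t0 zy rho.
have [N0 cRe] := controlled_part (or_introl erefl) wg fin.
have [_ cIm] := controlled_part (or_intror erefl) wg fin.
set N := fine _ in N0 cRe cIm *.
have rho0 : 0 < rho.
  rewrite sqrtr_gt0 lt0r addr_ge0 ?sqr_ge0 // andbT paddr_eq0 ?sqr_ge0 // !sqrf_eq0.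
  by apply/negP => /andP[/eqP z0 /eqP y0]; apply: zy; rewrite z0 y0.
have final (dec : R) : 0 <= dec ->
    4 * (decay_constant W A * (1 + rho) * N * dec) <=
    16 * decay_constant W A * N * jap rho * ln (rho + rho^-1 + 1) * dec.
  move=> dec0.
  have -> : 4 * (decay_constant W A * (1 + rho) * N * dec) =
    4 * (decay_constant W A * N * dec) * (1 + rho) by ring.
  have -> : 16 * decay_constant W A * N * jap rho * ln (rho + rho^-1 + 1) * dec =
    4 * (decay_constant W A * N * dec) * (4 * (jap rho * ln (rho + rho^-1 + 1))) by ring.
  apply: ler_wpM2l; last exact: rho_factor_le.
  by rewrite mulr_ge0 // mulr_ge0 // mulr_ge0 // ltW.
have lt0 : 0 <= ln (t + 2) by have := ln_ge_half (ltW t0); lra.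
split.
- apply: le_trans (final _ _); last by rewrite divr_ge0 // powR_ge0.
  by apply: cmod_oscillation_le => alpha;
    [exact: (phi_z_oscillation_le W0 A0 weightW shearA N0 cRe)|
     exact: (phi_z_oscillation_le W0 A0 weightW shearA N0 cIm)].
- apply: le_trans (final _ _); last by rewrite divr_ge0 // sqrtr_ge0.
  by apply: cmod_oscillation_le => alpha;
    [exact: (phi_y_oscillation_le W0 A0 weightW shearA N0 cRe)|
     exact: (phi_y_oscillation_le W0 A0 weightW shearA N0 cIm)].
Qed.
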